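(* Let $X=(X_t)_{t=0,\dots,n}$ be a stationary Markov chain generated by the copula $C(u,v)=a\min(u,v)+(1-a)\max(u+v-1,0)$ and Bernoulli($p$) marginal distribution, with parameter $\boldsymbol\theta=(a,p)$ in the open set $\Theta=(0,1)\times(0,1/2)$ or $\Theta=(0,1)\times(1/2,1)$. Then there exists an estimator $\hat{\boldsymbol\theta}=(\hat a,\hat p)$ which, with probability tending to $1$ as $n\to\infty$, is a solution of the maximum likelihood equations $\sum_{i,j\in\{0,1\}}\frac{n_{ij}}{p_{ij}(\boldsymbol\theta)}\frac{\partial p_{ij}(\boldsymbol\theta)}{\partial\theta_u}=0$, $u=1,2$, which converges in probability to $\boldsymbol\theta$, and such that $\sqrt{n+1}(\hat{\boldsymbol\theta}-\boldsymbol\theta)\to N_2(\mathbf 0,\Sigma^{-1})$ in distribution, where (coordinates ordered $(a,p)$) $$\Sigma^{-1}=\begin{pmatrix}\frac{a(1-a)}{p} & a(1-p)\\ a(1-p) & \frac{p(1-p)(a+1-2p)}{1-a}\end{pmatrix}\ \text{ if } p<1/2,\qquad \Sigma^{-1}=\begin{pmatrix}\frac{a(1-a)}{1-p} & -ap\\ -ap & \frac{p(1-p)(2p-1+a)}{1-a}\end{pmatrix}\ \text{ if } p>1/2.$$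
   Context: A stationary Markov chain $(X_t)$ is generated by a copula $C$ and a marginal cdf $F$ if each $X_t$ has cdf $F$ and $P(X_t\le x,X_{t+1}\le y)=C(F(x),F(y))$ for all $x,y$; Bernoulli($p$) means $P(X_t=1)=p$. The transition probabilities $p_{ij}(\boldsymbol\theta)=P(X_{t+1}=j\mid X_t=i)$ are: for $p<1/2$, $p_{00}=\frac{ap+1-2p}{1-p}$, $p_{01}=\frac{p(1-a)}{1-p}$, $p_{10}=1-a$, $p_{11}=a$; for $p\ge1/2$, $p_{00}=a$, $p_{01}=1-a$, $p_{10}=\frac{(1-p)(1-a)}{p}$, $p_{11}=\frac{a(1-p)+2p-1}{p}$. The transition counts are $n_{ij}=\#\{t\in\{0,\dots,n-1\}:X_t=i,X_{t+1}=j\}$. *)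

(* Defs.v *)
From HB Require Import structures.
From mathcomp Require Import all_boot all_order all_algebra.
From mathcomp Require Import all_classical all_reals all_analysis.
Set Implicit Arguments. Unset Strict Implicit. Unset Printing Implicit Defensive.
Import Order.TTheory GRing.Theory Num.Theory.
Import numFieldNormedType.Exports.
Local Open Scope classical_set_scope.
Local Open Scope ring_scope.

Section Model.
Variable R : realType.

(* States: false = 0, true = 1.  Transition probabilities p_ij(a,p). *)
Definition trans (a p : R) (i j : bool) : R :=
  if p < 2^-1 then
    match i, j with
    | false, false => (a * p + 1 - 2 * p) / (1 - p)
    | false, true  => p * (1 - a) / (1 - p)
    | true,  false => 1 - a
    | true,  true  => a
    end
  else
    match i, j with
    | false, false => a
    | false, true  => 1 - a
    | true,  false => (1 - p) * (1 - a) / p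
    | true,  true  => (a * (1 - p) + 2 * p - 1) / p
    end.

Definition init (p : R) (i : bool) : R := if i then p else 1 - p.

Definition cpath (n : nat) := {ffun 'I_n.+1 -> bool}.
Definition st (n : nat) (x : cpath n) (t : nat) : bool := x (inord t).

Definition path_prob (a p : R) (n : nat) (x : cpath n) : R :=
  init p (st x 0) * \prod_(0 <= t < n) trans a p (st x t) (st x t.+1).

Definition Prob (a p : R) (n : nat) (E : pred (cpath n)) : R :=
  \sum_(x : cpath n | E x) path_prob a p x.

Definition Expect (a p : R) (n : nat) (g : cpath n -> R) : R :=
  \sum_(x : cpath n) path_prob a p x * g x.

Definition ncount (n : nat) (x : cpath n) (i j : bool) : nat :=
  #|[set t : 'I_n | (st x t == i) && (st x t.+1 == j)]|.

Definition inTheta (hi : bool) (a p : R) : bool :=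
  (0 < a < 1) && (if hi then 2^-1 < p < 1 else 0 < p < 2^-1).

Definition dtrans_a (a p : R) (i j : bool) : R := derive1 (fun b => trans b p i j) a.
Definition dtrans_p (a p : R) (i j : bool) : R := derive1 (fun q => trans a q i j) p.

Definition ml_solution (hi : bool) (n : nat) (x : cpath n) (th : R * R) : bool :=
  inTheta hi th.1 th.2 &&
  ((\sum_(i : bool) \sum_(j : bool)
      (ncount x i j)%:R / trans th.1 th.2 i j * dtrans_a th.1 th.2 i j == 0) &&
   (\sum_(i : bool) \sum_(j : bool)
      (ncount x i j)%:R / trans th.1 th.2 i j * dtrans_p th.1 th.2 i j == 0)).

Definition s11 (a p : R) : R :=
  if p < 2^-1 then a * (1 - a) / p else a * (1 - a) / (1 - p).
Definition s12 (a p : R) : R :=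
  if p < 2^-1 then a * (1 - p) else - (a * p).
Definition s22 (a p : R) : R :=
  if p < 2^-1 then p * (1 - p) * (a + 1 - 2 * p) / (1 - a)
  else p * (1 - p) * (2 * p - 1 + a) / (1 - a).

Definition normal2_pdf (v11 v12 v22 : R) (z : R * R) : R :=
  let D := v11 * v22 - v12 ^+ 2 in
  (2 * pi * Num.sqrt D)^-1 *
  expR (- (v22 * z.1 ^+ 2 - 2 * v12 * z.1 * z.2 + v11 * z.2 ^+ 2) / (2 * D)).

Definition cvg_dist_normal2 (a p : R) (Z : forall n, cpath n -> R * R)
    (v11 v12 v22 : R) : Prop :=
  forall f : R * R -> R, continuous f -> (exists M : R, forall z, `|f z| <= M) ->
    ((Expect a p (fun x => f (Z n x)))%:E @[n --> \oo] -->
     (\int[(@lebesgue_measure R \x @lebesgue_measure R)%E]_z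
        (f z * normal2_pdf v11 v12 v22 z)%:E)%E).

End Model.

(* Main.v *)
(** The chain has two states; write [al] and [be] for the probabilities of
    leaving 0 and 1. In both parameter ranges p = al / (al + be), and the
    likelihood is maximal when the transition probabilities equal the observed
    frequencies, so the estimator is explicit.

    Everything is a function of the two martingales
    [M_b = sum_t 1(X_t = b) (X_(t+1) - P(b, 1))]: the error of the frequency of
    1 after b is [M_b] divided by the number of visits to b, and the numbers of
    visits are affine in [M_0 + M_1] up to a bounded term. The joint central
    limit theorem for [M_0] and [M_1] is proved by Lindeberg's method, with
    Gaussian densities as test functions: they form a solution of the heat
    equation, and a corrector solving the Poisson equation of the chain absorbs
    the dependence of the conditional variances on the state. Gaussian test
    functions suffice: the law of the statistic smoothed by a Gaussian has
    density converging pointwise, hence in L^1 by Scheffe's lemma, and the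
    smoothing is removed by letting its variance tend to 0. *)

Require Import Defs.
From HB Require Import structures.
From mathcomp Require Import all_boot all_order all_algebra.
From mathcomp Require Import all_classical all_reals all_analysis.
From mathcomp Require Import measurable_realfun ring lra.
Import Order.TTheory GRing.Theory Num.Theory.
Import numFieldNormedType.Exports.
Local Open Scope classical_set_scope.
Local Open Scope ring_scope.
Set Implicit Arguments. Unset Strict Implicit. Unset Printing Implicit Defensive.

(** * Trajectories *)

(** The obstacle is that each step moves only the martingale of the current state, so the
    conditional covariance of a step is degenerate; only its average under the stationary law is a
    multiple of the identity. After division by [scale], coordinate [b] receives conditional
    variance [h ^+ 2 / init p b] while the chain is in [b] and none otherwise: on average [h ^+ 2]
    each, without covariance. The limit is therefore a standard Gaussian vector, and the matrix of
    the statement enters only through an algebraic identity: the quadratic form of its Gaussian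
    density, evaluated at the linearized estimator, is a sum of two squares in the standardized
    martingales ([Theta_qform]). For this reason one isotropic kernel, translated arbitrarily,
    provides all test functions. With [h] the inverse square root of [n], a step costs [O(h ^+ 3)]
    uniformly in position as long as the variance of the kernel stays away from 0, so that [n] steps
    cost [O(h)]. The smoothing variance is therefore kept fixed while [n] tends to infinity, and is
    sent to 0 only afterwards. *)

Definition extend n (x : cpath n) (j : bool) : cpath n.+1 :=
  [ffun i : 'I_n.+2 => if (i < n.+1)%N then st x i else j].

Definition restrict n (x : cpath n.+1) : cpath n :=
  [ffun i : 'I_n.+1 => st x i].

Lemma st_extend n (x : cpath n) j t : (t <= n)%N -> st (extend x j) t = st x t.
Proof. by move=> tn; rewrite /st ffunE inordK ltnS ?(leqW tn)// tn. Qed.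

Lemma st_extend_last n (x : cpath n) j : st (extend x j) n.+1 = j.
Proof. by rewrite /st ffunE inordK// ltnn. Qed.

Lemma extend_bij n : bijective (fun u : cpath n * bool => extend u.1 u.2).
Proof.
exists (fun x => (restrict x, st x n.+1)) => [[x j]|x] /=.
  rewrite st_extend_last; congr pair; apply/ffunP => i.
  by rewrite ffunE st_extend /st ?inord_val// -ltnS.
apply/ffunP => i; rewrite ffunE; case: ifPn => [ilt|].
  by rewrite /st ffunE inordK// /st inord_val.
rewrite -leqNgt => ige; have -> : i = inord n.+1; last by [].
apply/val_inj => /=; rewrite inordK//; apply/eqP; rewrite eqn_leq ige andbT.
by rewrite -ltnS ltn_ord.
Qed.

Section Chain.
Context {R : realType}.
Variables (a p : R).

Lemma path_prob_extend n (x : cpath n) j :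
  path_prob a p (extend x j) = path_prob a p x * trans a p (st x n) j.
Proof.
rewrite /path_prob big_nat_recr//= st_extend// st_extend// st_extend_last mulrA.
congr (_ * _ * _); apply: eq_big_nat => t /andP[_ tn].
by rewrite !st_extend// ltnW.
Qed.

(** The Markov property: conditioning on the trajectory up to time [n] leaves an average over the
    next state. Every induction on time goes through it. *)
Lemma Expect_step n (g : cpath n.+1 -> R) :
  Expect a p g =
  Expect a p (fun x => \sum_(j : bool) trans a p (st x n) j * g (extend x j)).
Proof.
rewrite /Expect (reindex _ (onW_bij _ (extend_bij n)))/=.
rewrite -(pair_bigA _ (fun x j => path_prob a p (extend x j) * g (extend x j)))/=.
apply: eq_bigr => x _; rewrite big_distrr/=; apply: eq_bigr => j _.
by rewrite path_prob_extend mulrA.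
Qed.

Lemma Expect0 (g : cpath 0 -> R) :
  Expect a p g = \sum_(i : bool) init p i * g [ffun => i].
Proof.
have bij : bijective (fun i : bool => [ffun => i] : cpath 0).
  exists (fun x => st x 0) => [i|x]; first by rewrite /st ffunE.
  by apply/ffunP => i; rewrite ffunE /st; congr (x _); rewrite [i]ord1 [inord 0]ord1.
rewrite /Expect (reindex _ (onW_bij _ bij))/=; apply: eq_bigr => i _.
by rewrite /path_prob big_geq// mulr1 /st ffunE.
Qed.

Lemma eq_Expect n (f g : cpath n -> R) : f =1 g -> Expect a p f = Expect a p g.
Proof. by move=> fg; apply: eq_bigr => x _; rewrite fg. Qed.

Lemma ExpectD n (f g : cpath n -> R) :
  Expect a p (fun x => f x + g x) = Expect a p f + Expect a p g.
Proof. by rewrite -big_split/=; apply: eq_bigr => x _; rewrite mulrDr. Qed.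

Lemma ExpectZ n c (f : cpath n -> R) :
  Expect a p (fun x => c * f x) = c * Expect a p f.
Proof. by rewrite big_distrr/=; apply: eq_bigr => x _; rewrite mulrCA. Qed.

Lemma ExpectB n (f g : cpath n -> R) :
  Expect a p (fun x => f x - g x) = Expect a p f - Expect a p g.
Proof.
by rewrite -sumrB/=; apply: eq_bigr => x _; rewrite mulrBr.
Qed.

Lemma ProbE n (E : pred (cpath n)) : Prob a p E = Expect a p (fun x => (E x)%:R).
Proof.
rewrite /Prob big_mkcond/=; apply: eq_bigr => x _.
by case: (E x); rewrite ?mulr1 ?mulr0.
Qed.

Section Stochastic.
Hypothesis p01 : 0 <= p <= 1.
Hypothesis trans_ge0 : forall i j, 0 <= trans a p i j.
Hypothesis trans_sum : forall i, trans a p i true + trans a p i false = 1.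

Lemma path_prob_ge0 n (x : cpath n) : 0 <= path_prob a p x.
Proof.
case/andP: p01 => p0 p1; rewrite mulr_ge0 ?prodr_ge0//.
by rewrite /init; case: st => //; rewrite subr_ge0.
Qed.

Lemma ler_Expect n (f g : cpath n -> R) :
  (forall x, f x <= g x) -> Expect a p f <= Expect a p g.
Proof.
by move=> fg; apply: ler_sum => x _; rewrite ler_wpM2l// path_prob_ge0.
Qed.

Lemma Expect_cst n c : Expect a p (fun _ : cpath n => c) = c.
Proof.
elim: n => [|n IHn]; last first.
  rewrite Expect_step -[RHS]IHn; apply: eq_Expect => x.
  by rewrite big_bool/= -mulrDl trans_sum mul1r.
by rewrite Expect0 big_bool/= -mulrDl /init addrC subrK mul1r.
Qed.

Lemma ler_norm_Expect n (f : cpath n -> R) :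
  `|Expect a p f| <= Expect a p (fun x => `|f x|).
Proof.
apply: (le_trans (ler_norm_sum _ _ _)); apply: ler_sum => x _.
by rewrite normrM ger0_norm// path_prob_ge0.
Qed.

Lemma Prob_le1 n (E : pred (cpath n)) : Prob a p E <= 1.
Proof. by rewrite ProbE -[leRHS](Expect_cst n); apply: ler_Expect => x; case: (E x). Qed.

Lemma Prob_ge0 n (E : pred (cpath n)) : 0 <= Prob a p E.
Proof. by apply: sumr_ge0 => x _; exact: path_prob_ge0. Qed.

Lemma ler_Prob n (E F : pred (cpath n)) : (forall x, E x -> F x) ->
  Prob a p E <= Prob a p F.
Proof.
move=> EF; rewrite !ProbE; apply: ler_Expect => x.
by case: (E x) (EF x) => // ->.
Qed.

Lemma ProbC n (E : pred (cpath n)) : Prob a p (fun x => ~~ E x) = 1 - Prob a p E.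
Proof.
apply/eqP; rewrite eq_sym subr_eq eq_sym !ProbE -ExpectD -[eqbRHS](Expect_cst n).
by apply/eqP; apply: eq_Expect => x; case: (E x); rewrite ?addr0 ?add0r.
Qed.

Lemma Prob_chebyshev n (f : cpath n -> R) B : 0 < B ->
  Prob a p (fun x => B < `|f x|) <= Expect a p (fun x => f x ^+ 2) / B ^+ 2.
Proof.
move=> B0; rewrite ProbE mulrC -ExpectZ; apply: ler_Expect => x.
case: ltP => /= [Bf|_]; last by rewrite mulr_ge0 ?sqr_ge0// invr_ge0 sqr_ge0.
rewrite mulrC ler_pdivlMr ?exprn_gt0// mul1r -[f x ^+ 2]real_normK ?num_real//.
by rewrite lerXn2r ?nnegrE// ltW.
Qed.

(* The sets of trajectories, of all lengths together, of probability tending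
   to 1 form a filter; convergence along it is convergence in probability. *)
Definition cvg_prob : set_system {n & cpath n} := fun S =>
  Prob a p (fun x : cpath n => `[< S (existT _ n x) >]) @[n --> \oo] --> (1 : R).

(** Passing to complements turns an intersection of events into a union bound. *)
Lemma cvg_probP (S : set {n & cpath n}) :
  (forall e, 0 < e -> \forall n \near \oo,
     Prob a p (fun x : cpath n => ~~ `[< S (existT _ n x) >]) <= e) <-> cvg_prob S.
Proof.
split=> [H|/cvgrPdist_le H e e0].
  apply/cvgrPdist_le => e /H; apply: filterS => n.
  by rewrite ProbC ger0_norm// subr_ge0 Prob_le1.
move/H: (e0); apply: filterS => n.
by rewrite ProbC ger0_norm// subr_ge0 Prob_le1.
Qed.

Lemma cvg_prob_filter : Filter cvg_prob.
Proof.
split.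
- apply/cvg_probP => e e0; apply: nearW => n.
  by rewrite ProbC [X in 1 - X](_ : _ = 1) ?subrr ?ltW// ProbE -[RHS](Expect_cst n);
    apply: eq_Expect => x; rewrite asboolT.
- move=> P Q /cvg_probP HP /cvg_probP HQ; apply/cvg_probP => e e0.
  have e20 : 0 < e / 2 by rewrite divr_gt0.
  move: (HP _ e20) (HQ _ e20); apply: filterS2 => n HPn HQn.
  rewrite [leRHS]splitr (le_trans _ (lerD HPn HQn))// !ProbE -ExpectD.
  apply: ler_Expect => x; rewrite asbool_and.
  by case: asboolP; case: asboolP; rewrite /= ?addr0 ?add0r// lerDl.
- move=> P Q PQ /cvg_probP HP; apply/cvg_probP => e /HP.
  apply: filterS => n; apply: le_trans; apply: ler_Prob => x.
  by apply: contra => /asboolP Px; apply/asboolP/PQ.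
Qed.

End Stochastic.
End Chain.

(** * Expansion of Gaussian test functions *)

Section Taylor.
Context {R : realType}.
Implicit Types (f g dg : R -> R) (C h x : R).

(** The increment [h] may have either sign. The condition [0 <= h -> x <= y] confines the hypothesis
    to the forward side when [h] is nonnegative: this matters for the variance, which must not drop
    below its lower bound. *)
Lemma MVT_increment g dg x h :
  (forall y, `|y - x| <= `|h| -> (0 <= h -> x <= y) -> is_derive y 1 g (dg y)) ->
  exists c, [/\ `|c - x| <= `|h|, 0 <= h -> x <= c & g (x + h) - g x = dg c * h].
Proof.
move=> dgP.
have cont (a b : R) : (forall y, y \in `[a, b]%R -> is_derive y 1 g (dg y)) ->
    {within `[a, b], continuous g}.
  move=> dab; apply: derivable_within_continuous => y yab.
  by have := dab y yab => -[].
have [h0|h0] := leP 0 h.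
- have dab y : y \in `[x, x + h]%R -> is_derive y 1 g (dg y).
    rewrite in_itv/= => /andP[xy yxh]; apply: dgP => //.
    by rewrite (ger0_norm h0) ger0_norm ?subr_ge0// lerBlDl.
  have xxh : x <= x + h by rewrite lerDl.
  have [c] := MVT_segment xxh (fun y yab => dab y (subset_itv_oo_cc yab)) (cont _ _ dab).
  rewrite in_itv/= => /andP[xc cxh] E; exists c; split => //.
    by rewrite (ger0_norm h0) ger0_norm ?subr_ge0// lerBlDl.
  by rewrite E; congr (_ * _); ring.
- have dab y : y \in `[x + h, x]%R -> is_derive y 1 g (dg y).
    rewrite in_itv/= => /andP[xy yxh]; apply: dgP => //.
      by rewrite (ltr0_norm h0) ler0_norm ?subr_le0//; lra.
    by move=> h1; lra.
  have xxh : x + h <= x by lra.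
  have [c] := MVT_segment xxh (fun y yab => dab y (subset_itv_oo_cc yab)) (cont _ _ dab).
  rewrite in_itv/= => /andP[xc cxh] E; exists c; split => //.
    by rewrite (ltr0_norm h0) ler0_norm ?subr_le0//; lra.
  by rewrite -opprB E; ring.
Qed.

Lemma Lipschitz_increment g dg C x h :
  (forall y, `|y - x| <= `|h| -> (0 <= h -> x <= y) -> is_derive y 1 g (dg y)) ->
  (forall y, `|y - x| <= `|h| -> (0 <= h -> x <= y) -> `|dg y| <= C) ->
  `|g (x + h) - g x| <= C * `|h|.
Proof.
move=> /MVT_increment[c [cx xc ->]] dgC.
by rewrite normrM ler_wpM2r// dgC.
Qed.

(** The mean value theorem is applied to [f] minus its tangent slope, then to [f1]. The constant is
    not optimal, since only the order in [h] matters; likewise in [Taylor3]. *)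
Lemma Taylor2_forward f f1 f2 C x h : 0 <= h ->
  (forall y, x <= y <= x + h -> is_derive y 1 f (f1 y)) ->
  (forall y, x <= y <= x + h -> is_derive y 1 f1 (f2 y)) ->
  (forall y, x <= y <= x + h -> `|f2 y| <= C) ->
  `|f (x + h) - f x - h * f1 x| <= C * h ^+ 2.
Proof.
move=> h0 df df1 f2C.
have xy y k : 0 <= k <= h -> `|y - x| <= `|k| -> (0 <= k -> x <= y) ->
    x <= y <= x + h.
  move=> /andP[k0 kh] + /(_ k0) xy; rewrite xy (ger0_norm k0) ger0_norm ?subr_ge0//=.
  by rewrite lerBlDl => /le_trans -> //; rewrite lerD2l.
have /MVT_increment[c [cx xc]] : forall y, `|y - x| <= `|h| ->
    (0 <= h -> x <= y) ->
    is_derive y 1 (fun y => f y - y * f1 x) (f1 y - f1 x).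
  move=> y y1 y2; have := df y; rewrite (xy y h)// ?h0 ?lexx// => /(_ isT) dfy.
  apply: is_derive_eq.
  by rewrite /GRing.scale/=; ring.
rewrite (_ : _ - _ - _ = f (x + h) - (x + h) * f1 x - (f x - x * f1 x)); last by ring.
move=> ->.
have cxh : 0 <= c - x <= h.
  by rewrite subr_ge0 xc//= -(ger0_norm h0); apply: le_trans cx; exact: ler_norm.
have -> : f1 c = f1 (x + (c - x)) by congr f1; ring.
have c0 : 0 <= c - x by case/andP: cxh.
rewrite normrM (ger0_norm h0) expr2 mulrA ler_wpM2r//.
apply: (@le_trans _ _ (C * `|c - x|)).
  apply: Lipschitz_increment => y y1 y2; first exact: df1 (xy _ _ _ y1 y2).
  exact: f2C (xy _ _ _ y1 y2).
rewrite ger0_norm// ler_wpM2l//; last by case/andP: cxh.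
by apply: le_trans (f2C x _); rewrite ?normr_ge0// lexx lerDl.
Qed.

Lemma Taylor3 f f1 f2 f3 C x h :
  (forall y : R, is_derive y 1 f (f1 y)) -> (forall y : R, is_derive y 1 f1 (f2 y)) ->
  (forall y : R, is_derive y 1 f2 (f3 y)) -> (forall y, `|f3 y| <= C) ->
  `|f (x + h) - f x - h * f1 x - h ^+ 2 / 2 * f2 x| <= C * `|h| ^+ 3.
Proof.
move=> df df1 df2 f3C.
have C0 : 0 <= C by exact: le_trans (f3C 0).
have L2 k : `|f2 (x + k) - f2 x| <= C * `|k|.
  by apply: Lipschitz_increment => y _ _.
have L1 k : `|f1 (x + k) - f1 x - k * f2 x| <= C * `|k| ^+ 2.
  have /MVT_increment[c [cx _]] : forall y, `|y - x| <= `|k| ->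
    (0 <= k -> x <= y) -> is_derive y 1 (fun y => f1 y - y * f2 x) (f2 y - f2 x).
    by move=> y _ _; apply: is_derive_eq; rewrite /GRing.scale/=; ring.
  rewrite (_ : _ - _ - _ = f1 (x + k) - (x + k) * f2 x - (f1 x - x * f2 x)); last by ring.
  move=> ->; have -> : f2 c = f2 (x + (c - x)) by congr f2; ring.
  rewrite normrM expr2 mulrA ler_wpM2r//; apply: (le_trans (L2 _)).
  by rewrite ler_wpM2l.
have /MVT_increment[c [cx _]] : forall y, `|y - x| <= `|h| ->
    (0 <= h -> x <= y) ->
    is_derive y 1 (fun y => f y - y * f1 x - (y - x) ^+ 2 / 2 * f2 x)
      (f1 y - f1 x - (y - x) * f2 x).
  by move=> y _ _; apply: is_derive_eq; rewrite /GRing.scale/=; field.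
set A := (X in X = _); set B := (X in `|X|) => AB.
have -> : B = A by rewrite /A /B; field.
rewrite AB; have -> : f1 c = f1 (x + (c - x)) by congr f1; ring.
rewrite normrM [_ ^+ 3]exprSr mulrA ler_wpM2r//; apply: (le_trans (L1 _)).
by rewrite ler_wpM2l// lerXn2r ?nnegrE.
Qed.

End Taylor.

(** * The isotropic Gaussian kernel and its derivatives *)

Section Bump.
Context {R : realType}.
Implicit Types (i x y t : R).

(** The parameter is the inverse variance, so that every derivative below is a polynomial in [i],
    [x], [y] times [gexp] and can be bounded monomial by monomial. *)
Definition gexp i x y := expR (- (x ^+ 2 + y ^+ 2) * i / 2).
(* As a function of the variance [t = i^-1], this multiple of the Gaussian
   density of covariance [t] solves the heat equation: see [is_derive_bumpt]. *)
Definition bump i x y := i * gexp i x y.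
Definition bumpx i x y := (- x * i ^+ 2) * gexp i x y.
(** Since [bump] is symmetric, its second derivative in [y] is [bumpxx i y x]. *)
Definition bumpxx i x y := (x ^+ 2 * i ^+ 3 - i ^+ 2) * gexp i x y.
Definition bumpxxx i x y := (3 * x * i ^+ 3 - x ^+ 3 * i ^+ 4) * gexp i x y.
Definition bumpxxy i x y := (- y * i * (x ^+ 2 * i ^+ 3 - i ^+ 2)) * gexp i x y.

Lemma gexpC i x y : gexp i x y = gexp i y x.
Proof. by rewrite /gexp addrC. Qed.

Lemma bumpC i x y : bump i x y = bump i y x.
Proof. by rewrite /bump gexpC. Qed.

Lemma is_derive_bump i x y : is_derive x 1 (fun x => bump i x y) (bumpx i x y).
Proof.
rewrite /bump /bumpx /gexp.
by apply: is_derive_eq; rewrite /GRing.scale/=; field.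
Qed.

Lemma is_derive_bumpx i x y : is_derive x 1 (fun x => bumpx i x y) (bumpxx i x y).
Proof.
rewrite /bumpxx /bumpx /gexp.
by apply: is_derive_eq; rewrite /GRing.scale/=; field.
Qed.

Lemma is_derive_bumpxx i x y : is_derive x 1 (fun x => bumpxx i x y) (bumpxxx i x y).
Proof.
rewrite /bumpxx /bumpxxx /gexp.
by apply: is_derive_eq; rewrite /GRing.scale/=; field.
Qed.

Lemma is_derive_bumpxxy i x y : is_derive y 1 (fun y => bumpxx i x y) (bumpxxy i x y).
Proof.
rewrite /bumpxx /bumpxxy /gexp.
by apply: is_derive_eq; rewrite /GRing.scale/=; field.
Qed.

Definition bumptt i x y :=
  (4^-1 * (x ^+ 2 + y ^+ 2) ^+ 2 * i ^+ 5 - 2 * (x ^+ 2 + y ^+ 2) * i ^+ 4 + 2 * i ^+ 3)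
    * gexp i x y.
Definition bumpxxt i x y :=
  (2^-1 * (x ^+ 2 + y ^+ 2) * x ^+ 2 * i ^+ 5 - 2^-1 * (x ^+ 2 + y ^+ 2) * i ^+ 4
    - 3 * x ^+ 2 * i ^+ 4 + 2 * i ^+ 3) * gexp i x y.

Lemma is_derive_invr (F : R -> R) t d : t != 0 ->
  is_derive t^-1 1 F d -> is_derive t 1 (fun t => F t^-1) (- t^-1 ^+ 2 * d).
Proof.
move=> t0 dF; have dV : is_derive t 1 (fun t : R => t^-1) (- t ^- 2 *: 1).
  exact: (@is_deriveV _ id).
by apply: (is_derive_eq (is_derive1_comp dF dV)); rewrite /GRing.scale/= mulr1 mulrC exprVn.
Qed.

Lemma is_derive_bumpt t x y : t != 0 ->
  is_derive t 1 (fun t => bump t^-1 x y) (2^-1 * (bumpxx t^-1 x y + bumpxx t^-1 y x)).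
Proof.
move=> t0.
have dF : is_derive t^-1 1 (fun i => bump i x y)
    ((1 - t^-1 * (x ^+ 2 + y ^+ 2) / 2) * gexp t^-1 x y).
  by rewrite /bump /gexp; apply: is_derive_eq; rewrite /GRing.scale/=; field.
apply: (is_derive_eq (is_derive_invr t0 dF)).
by rewrite /bumpxx [gexp _ y x]gexpC; set i := t^-1; field.
Qed.

Lemma is_derive_bumpxxt t x y : t != 0 ->
  is_derive t 1 (fun t => bumpxx t^-1 x y) (bumpxxt t^-1 x y).
Proof.
move=> t0.
have dF : is_derive t^-1 1 (fun i => bumpxx i x y)
    ((3 * x ^+ 2 * t^-1 ^+ 2 - 2 * t^-1 - (x ^+ 2 * t^-1 ^+ 3 - t^-1 ^+ 2) * (x ^+ 2 + y ^+ 2) / 2)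
    * gexp t^-1 x y).
  by rewrite /bumpxx /gexp; apply: is_derive_eq; rewrite /GRing.scale/=; field.
apply: (is_derive_eq (is_derive_invr t0 dF)).
by rewrite /bumpxxt; set i := t^-1; field.
Qed.

Lemma is_derive_bumptt t x y : t != 0 ->
  is_derive t 1 (fun t => 2^-1 * (bumpxx t^-1 x y + bumpxx t^-1 y x)) (bumptt t^-1 x y).
Proof.
move=> t0; have d1 := is_derive_bumpxxt x y t0; have d2 := is_derive_bumpxxt y x t0.
apply: is_derive_eq; rewrite /GRing.scale/= /bumpxxt /bumptt [gexp _ y x]gexpC.
by set i := t^-1; field.
Qed.

End Bump.

(** * Bounds on these derivatives, uniform over the plane *)

Section BumpBounds.
Context {R : realType}.
Variables i0 i1 : R.
Hypothesis i00 : 0 < i0.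
Implicit Types (i x y : R) (f g : R -> R -> R -> R).

Lemma gexp_decay (N : nat) : exists K, forall i x y, i0 <= i ->
  (1 + (x ^+ 2 + y ^+ 2)) ^+ N * gexp i x y <= K.
Proof.
(* The exponential of [s * i0 / 2] is a product of [N.+1] factors [expR (s * c)], each of which
   dominates [m * (1 + s)] because [1 + u <= expR u]. Taking [N.+1] factors instead of [N] keeps [c]
   meaningful for [N = 0]. *)
pose c := i0 / 2 / N.+1%:R; pose m := Num.min 1 c.
have c0 : 0 < c by rewrite !divr_gt0.
have m0 : 0 < m by rewrite lt_min ltr01.
exists (m^-1 ^+ N.+1) => i x y ii.
set s := x ^+ 2 + y ^+ 2; have s0 : 0 <= s by rewrite addr_ge0 ?sqr_ge0.
have le1 : m * (1 + s) <= expR (s * c).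
  apply: le_trans (expR_ge1Dx _); rewrite mulrDr mulr1 lerD//.
    by rewrite /m ge_min lexx.
  by rewrite mulrC ler_wpM2l// /m ge_min lexx orbT.
have le2 : gexp i x y <= (expR (s * c))^-1 ^+ N.+1.
  rewrite -expRN -expRM_natl ler_expR -/s /c.
  rewrite (_ : N.+1%:R * _ = - (s * (i0 / 2))); last first.
    by field; rewrite addrC natr1 pnatr_eq0.
  by rewrite -mulrA mulNr lerN2 ler_wpM2l// ler_wpM2r.
have s1 : 1 <= 1 + s by rewrite lerDl.
have s1' : 0 < 1 + s by rewrite (lt_le_trans ltr01).
apply: (@le_trans _ _ ((1 + s) ^+ N.+1 * gexp i x y)).
  by rewrite ler_wpM2r ?expR_ge0// ler_weXn2l.
apply: (le_trans (ler_wpM2l _ le2)); first by rewrite exprn_ge0// ltW.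
have d0 : 0 <= (1 + s) / expR (s * c) by rewrite divr_ge0 ?expR_ge0// ltW.
have d1 : 0 <= m^-1 by rewrite invr_ge0 ltW.
rewrite -exprMn lerXn2r//.
rewrite ler_pdivrMr ?expR_gt0// mulrC ler_pdivlMr//.
by rewrite mulrC.
Qed.

Definition bounded3 f := exists C, forall i x y, i0 <= i <= i1 -> `|f i x y| <= C.

(** Both [|x|] and [|y|] are at most [1 + (x ^+ 2 + y ^+ 2)], so [gexp_decay] with exponent [m + n]
    absorbs the monomial. *)
Lemma bounded3_monomial (m n k : nat) :
  bounded3 (fun i x y => x ^+ m * y ^+ n * i ^+ k * gexp i x y).
Proof.
have [K HK] := gexp_decay (m + n).
exists (i1 ^+ k * K) => i x y /andP[ii i1i].
have i_ge0 : 0 <= i by rewrite (le_trans _ ii)// ltW.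
rewrite mulrAC mulrC !normrM (ger0_norm (expR_ge0 _)) !normrX (ger0_norm i_ge0).
apply: ler_pM => //; rewrite ?exprn_ge0// ?mulr_ge0 ?exprn_ge0 ?expR_ge0//.
  by rewrite lerXn2r ?nnegrE// (le_trans i_ge0).
apply: le_trans (HK i x y ii); rewrite ler_wpM2r ?expR_ge0// exprD.
have le1 (z w : R) : `|z| <= 1 + (z ^+ 2 + w ^+ 2).
  by rewrite ler_norml; apply/andP; split; nra.
apply: ler_pM; rewrite ?exprn_ge0//; rewrite lerXn2r ?nnegrE//.
- by rewrite addr_ge0// addr_ge0 ?sqr_ge0.
- by rewrite addr_ge0// addr_ge0 ?sqr_ge0.
- by rewrite [x ^+ 2 + _]addrC.
Qed.

Lemma bounded3D f g : bounded3 f -> bounded3 g ->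
  bounded3 (fun i x y => f i x y + g i x y).
Proof.
move=> [C HC] [D HD]; exists (C + D) => i x y ii.
by rewrite (le_trans (ler_normD _ _))// lerD ?HC ?HD.
Qed.

Lemma bounded3Z c f : bounded3 f -> bounded3 (fun i x y => c * f i x y).
Proof.
move=> [C HC]; exists (`|c| * C) => i x y ii.
by rewrite normrM ler_wpM2l// HC.
Qed.

Let mono m n k i x y : R := x ^+ m * y ^+ n * i ^+ k * gexp i x y.

Lemma bounded3_bumpxx : bounded3 bumpxx.
Proof.
rewrite [bumpxx](_ : _ = fun i x y => mono 2 0 3 i x y + (- 1) * mono 0 0 2 i x y).
  by apply: bounded3D; last apply: bounded3Z; exact: bounded3_monomial.
by apply/funext => i; apply/funext => x; apply/funext => y; rewrite /mono /bumpxx; ring.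
Qed.

Lemma bounded3_bumpxxx : bounded3 bumpxxx.
Proof.
rewrite [bumpxxx](_ : _ = fun i x y => 3 * mono 1 0 3 i x y + (- 1) * mono 3 0 4 i x y).
  by apply: bounded3D; apply: bounded3Z; exact: bounded3_monomial.
by apply/funext => i; apply/funext => x; apply/funext => y; rewrite /mono /bumpxxx; ring.
Qed.

Lemma bounded3_bumpxxy : bounded3 bumpxxy.
Proof.
rewrite [bumpxxy](_ : _ = fun i x y => mono 0 1 3 i x y + (- 1) * mono 2 1 4 i x y).
  by apply: bounded3D; last apply: bounded3Z; exact: bounded3_monomial.
by apply/funext => i; apply/funext => x; apply/funext => y; rewrite /mono /bumpxxy; ring.
Qed.

Lemma bounded3_bumptt : bounded3 bumptt.
Proof.
rewrite [bumptt](_ : _ = fun i x y => 4^-1 * mono 4 0 5 i x y +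
  (2^-1 * mono 2 2 5 i x y + (4^-1 * mono 0 4 5 i x y + ((-2) * mono 2 0 4 i x y +
  ((-2) * mono 0 2 4 i x y + 2 * mono 0 0 3 i x y))))).
  by do 5 (apply: bounded3D; first by apply: bounded3Z; exact: bounded3_monomial);
    apply: bounded3Z; exact: bounded3_monomial.
by apply/funext => i; apply/funext => x; apply/funext => y; rewrite /mono /bumptt; field.
Qed.

Lemma bounded3_bumpxxt : bounded3 bumpxxt.
Proof.
rewrite [bumpxxt](_ : _ = fun i x y => 2^-1 * mono 4 0 5 i x y +
  (2^-1 * mono 2 2 5 i x y + ((- (7 / 2)) * mono 2 0 4 i x y +
  ((- 2^-1) * mono 0 2 4 i x y + 2 * mono 0 0 3 i x y)))).
  by do 4 (apply: bounded3D; first by apply: bounded3Z; exact: bounded3_monomial);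
    apply: bounded3Z; exact: bounded3_monomial.
by apply/funext => i; apply/funext => x; apply/funext => y; rewrite /mono /bumpxxt; field.
Qed.

End BumpBounds.

(** * One step of Lindeberg's method *)

Section OneStep.
Context {R : realType}.
Implicit Types (x y h d t : R).

(** A single constant serves all positions and all variances in [[v, V]] because [v] is positive.
    Space increments [d] have either sign; variance increments [h] go forward only. *)
Lemma bump_expansion (v V : R) : 0 < v -> v <= V -> exists C, forall t x y,
  v <= t <= V ->
  [/\ forall d, `|bump t^-1 (x + d) y - bump t^-1 x y - d * bumpx t^-1 x y
        - d ^+ 2 / 2 * bumpxx t^-1 x y| <= C * `|d| ^+ 3,
      forall d, `|bumpxx t^-1 (x + d) y - bumpxx t^-1 x y| <= C * `|d|,
      forall d, `|bumpxx t^-1 y (x + d) - bumpxx t^-1 y x| <= C * `|d|,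
      forall h, 0 <= h -> t + h <= V -> `|bump (t + h)^-1 x y - bump t^-1 x y -
         h * (2^-1 * (bumpxx t^-1 x y + bumpxx t^-1 y x))| <= C * h ^+ 2 &
      forall h, 0 <= h -> t + h <= V ->
        `|bumpxx (t + h)^-1 x y - bumpxx t^-1 x y| <= C * h].
Proof.
move=> v0 vV; have V0 : 0 < V by exact: lt_le_trans vV.
have I0 : 0 < V^-1 by rewrite invr_gt0.
have [C1 H1] := bounded3_bumpxxx v^-1 I0.
have [C2 H2] := bounded3_bumpxxy v^-1 I0.
have [C3 H3] := bounded3_bumptt v^-1 I0.
have [C4 H4] := bounded3_bumpxxt v^-1 I0.
pose C := Num.max (Num.max C1 C2) (Num.max C3 C4).
have C1C : C1 <= C by rewrite !le_max lexx.
have C2C : C2 <= C by rewrite !le_max lexx ?orbT.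
have C3C : C3 <= C by rewrite !le_max lexx ?orbT.
have C4C : C4 <= C by rewrite !le_max lexx ?orbT.
have inv t : v <= t <= V -> V^-1 <= t^-1 <= v^-1.
  move=> /andP[vt tV]; have t0 : 0 < t by exact: lt_le_trans vt.
  by rewrite !lef_pV2 ?posrE ?tV.
exists C => t x y tvV; have tvV' := inv _ tvV.
have near h s : 0 <= h -> t + h <= V -> `|s - t| <= `|h| -> (0 <= h -> t <= s) ->
    v <= s <= V.
  move=> h0 thV sth /(_ h0) ts; case/andP: tvV => vt tV.
  rewrite (le_trans vt ts)/=; apply: le_trans thV.
  by rewrite -lerBlDl; apply: le_trans (ler_norm _) _; rewrite -(ger0_norm h0).
have neq0 s : v <= s <= V -> s != 0 by move=> /andP[vs _]; rewrite gt_eqF// (lt_le_trans v0).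
split=> [d|d|d|h h0 hV|h h0 hV].
- apply: (@Taylor3 _ (fun x => bump t^-1 x y) (fun x => bumpx t^-1 x y)
    (fun x => bumpxx t^-1 x y) (fun x => bumpxxx t^-1 x y)).
  + by move=> z; exact: is_derive_bump.
  + by move=> z; exact: is_derive_bumpx.
  + by move=> z; exact: is_derive_bumpxx.
  + by move=> z; rewrite (le_trans _ C1C)// H1.
- apply: (@Lipschitz_increment _ (fun x => bumpxx t^-1 x y) (fun x => bumpxxx t^-1 x y)) => z _ _.
  + exact: is_derive_bumpxx.
  + by rewrite (le_trans _ C1C)// H1.
- apply: (@Lipschitz_increment _ (fun x => bumpxx t^-1 y x) (fun x => bumpxxy t^-1 y x)) => z _ _.
  + exact: is_derive_bumpxxy.
  + by rewrite (le_trans _ C2C)// H2.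
- apply: (@Taylor2_forward _ (fun t => bump t^-1 x y)
    (fun t => 2^-1 * (bumpxx t^-1 x y + bumpxx t^-1 y x)) (fun t => bumptt t^-1 x y)
    C t h h0).
  + move=> s /andP[ts sth]; apply: is_derive_bumpt; apply: neq0.
    by case/andP: tvV => vt _; rewrite (le_trans vt)// (le_trans sth).
  + move=> s /andP[ts sth]; apply: is_derive_bumptt; apply: neq0.
    by case/andP: tvV => vt _; rewrite (le_trans vt)// (le_trans sth).
  + move=> s /andP[ts sth]; rewrite (le_trans _ C3C)// H3// inv//.
    by case/andP: tvV => vt _; rewrite (le_trans vt)// (le_trans sth).
- rewrite -[in leRHS](ger0_norm h0).
  apply: (@Lipschitz_increment _ (fun t => bumpxx t^-1 x y) (fun t => bumpxxt t^-1 x y)) => s s1 s2.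
  + by apply: is_derive_bumpxxt; apply: neq0; apply: near s1 s2.
  + by rewrite (le_trans _ C4C)// H4// inv//; apply: near s1 s2.
Qed.

(** Up to the factor [h ^+ 2 / 2], the difference between the second-order terms of a step from the
    state of mass [pi], which moves [x], and from the other state, which moves [y]. The deviation
    from their stationary mean, half the Laplacian times [h ^+ 2], is [1 - pi] times this difference
    in the first state and [- pi] times it in the second. *)
Definition corrector (pi t x y : R) := bumpxx t^-1 x y / pi - bumpxx t^-1 y x / (1 - pi).

(** The chain is in the state of mass [pi]; it stays with probability [s], displacing [x] by [ds],
    or leaves, displacing [x] by [dl]. The equation on [kappa] is the Poisson equation at this
    state: the function equal to [kappa * (1 - pi)] here and [- kappa * pi] in the other state has
    mean [kappa * (s - pi)] after one step. The variance of the step is traded for an increase of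
    [t] by [h ^+ 2], through the heat equation. *)
Lemma lindeberg_step (v V pi s kappa K : R) :
  0 < v -> v <= V -> 0 < pi < 1 -> 0 <= s <= 1 -> 0 <= K ->
  kappa * (s - pi) + (1 - pi) = kappa * (1 - pi) ->
  exists C, forall t x y h ds dl, 0 <= h <= 1 -> v <= t -> t + h ^+ 2 <= V ->
  s * ds + (1 - s) * dl = 0 -> s * ds ^+ 2 + (1 - s) * dl ^+ 2 = h ^+ 2 / pi ->
  `|ds| <= K * h -> `|dl| <= K * h ->
  `| s * (bump t^-1 (x + ds) y
           + h ^+ 2 / 2 * kappa * (1 - pi) * corrector pi t (x + ds) y)
     + (1 - s) * (bump t^-1 (x + dl) y
           - h ^+ 2 / 2 * kappa * pi * corrector pi t (x + dl) y)
     - (bump (t + h ^+ 2)^-1 x y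
           + h ^+ 2 / 2 * kappa * (1 - pi) * corrector pi (t + h ^+ 2) x y) |
  <= C * h ^+ 3.
Proof.
move=> v0 vV /andP[pi0 pi1] /andP[s0 s1] K0 kE; have [C HC] := bump_expansion v0 vV.
have C0 : 0 <= C.
  have [|_ H _ _ _] := HC v 0 0; first by rewrite lexx.
  by have := le_trans (normr_ge0 _) (H 1); rewrite normr1 mulr1.
pose c := pi^-1 + (1 - pi)^-1.
have pi1' : 0 < 1 - pi by rewrite subr_gt0.
have c0 : 0 < c by rewrite addr_gt0// invr_gt0.
(* In this order: the spatial Taylor remainders, the remainder of the heat equation, and the
   variation of the corrector in space and in variance. *)
exists (C * K ^+ 3 + C + `|kappa| * (C * K * c + C * c)).
move=> t x y h ds dl /andP[h0 h1] vt tV E1 E2 dsK dlK.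
have h20 : 0 <= h ^+ 2 by rewrite sqr_ge0.
have tvV : v <= t <= V by rewrite vt (le_trans _ tV)// lerDl.
have [T1 T2 T3 T4 T5] := HC t x y tvV.
have [_ _ _ _ T5'] := HC t y x tvV.
have Hr d : `|d| <= K * h -> exists2 r, `|r| <= C * K ^+ 3 * h ^+ 3 &
    bump t^-1 (x + d) y = bump t^-1 x y + d * bumpx t^-1 x y
      + d ^+ 2 / 2 * bumpxx t^-1 x y + r.
  move=> dK; exists (bump t^-1 (x + d) y - bump t^-1 x y - d * bumpx t^-1 x y
        - d ^+ 2 / 2 * bumpxx t^-1 x y); last by ring.
  apply: le_trans (T1 d) _; rewrite -mulrA -exprMn ler_wpM2l// lerXn2r ?nnegrE ?mulr_ge0//.
have [r1 r1C ->] := Hr _ dsK; have [r2 r2C ->] := Hr _ dlK.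
have [r3 r3C ->] : exists2 r, `|r| <= C * h ^+ 3 & bump (t + h ^+ 2)^-1 x y =
    bump t^-1 x y + h ^+ 2 * (2^-1 * (bumpxx t^-1 x y + bumpxx t^-1 y x)) + r.
  exists (bump (t + h ^+ 2)^-1 x y - bump t^-1 x y -
     h ^+ 2 * (2^-1 * (bumpxx t^-1 x y + bumpxx t^-1 y x))); last by ring.
  apply: le_trans (T4 _ h20 tV) _; rewrite -exprM ler_wpM2l//.
  by rewrite [leLHS]exprS ler_piMl// exprn_ge0.
have Hc (A B A' B' e : R) : `|A - A'| <= e -> `|B - B'| <= e ->
    `|(A / pi - B / (1 - pi)) - (A' / pi - B' / (1 - pi))| <= e * c.
  move=> AA BB; rewrite (_ : _ - _ = (A - A') / pi - (B - B') / (1 - pi)); last by ring.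
  rewrite (le_trans (ler_normB _ _))// mulrDr.
  have ip : 0 <= pi^-1 by rewrite invr_ge0 ltW.
  have iq : 0 <= (1 - pi)^-1 by rewrite invr_ge0 ltW.
  by apply: lerD; rewrite normrM (ger0_norm ip, ger0_norm iq) ler_wpM2r.
have Hq d : `|d| <= K * h -> exists2 r, `|r| <= C * K * c * h &
    corrector pi t (x + d) y = corrector pi t x y + r.
  move=> dK; exists (corrector pi t (x + d) y - corrector pi t x y); last by ring.
  rewrite -mulrA [c * h]mulrC mulrA; apply: Hc.
    by apply: le_trans (T2 d) _; rewrite -mulrA ler_wpM2l.
  by apply: le_trans (T3 d) _; rewrite -mulrA ler_wpM2l.
have [q1 q1C ->] := Hq _ dsK; have [q2 q2C ->] := Hq _ dlK.
have hh : h ^+ 2 <= h by rewrite expr2 ler_piMl.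
have [q3 q3C ->] : exists2 r, `|r| <= C * c * h &
    corrector pi (t + h ^+ 2) x y = corrector pi t x y + r.
  exists (corrector pi (t + h ^+ 2) x y - corrector pi t x y); last by ring.
  rewrite -mulrA [c * h]mulrC mulrA; apply: Hc.
    by apply: le_trans (T5 _ h20 tV) _; rewrite ler_wpM2l.
  by apply: le_trans (T5' _ h20 tV) _; rewrite ler_wpM2l.
set E := (X in `|X|).
have -> : E = (s * r1 + (1 - s) * r2 - r3)
   + h ^+ 2 / 2 * (kappa * (s * (1 - pi) * q1 - (1 - s) * pi * q2 - (1 - pi) * q3)).
  rewrite /E.
  (* Sorted by derivatives: the first-order term vanishes by [E1], the second-order term is
     evaluated by [E2], and its excess over the heat equation is cancelled by the corrector through
     [kE]. *)
  transitivity (bumpx t^-1 x y * (s * ds + (1 - s) * dl)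
    + 2^-1 * bumpxx t^-1 x y * (s * ds ^+ 2 + (1 - s) * dl ^+ 2)
    - h ^+ 2 / 2 * (bumpxx t^-1 x y + bumpxx t^-1 y x)
    + h ^+ 2 / 2 * corrector pi t x y * (kappa * (s - pi) - kappa * (1 - pi))
    + ((s * r1 + (1 - s) * r2 - r3)
   + h ^+ 2 / 2 * (kappa * (s * (1 - pi) * q1 - (1 - s) * pi * q2 - (1 - pi) * q3)))).
    by field.
  rewrite E1 E2 (_ : kappa * (s - pi) - kappa * (1 - pi) = - (1 - pi)); last first.
    by rewrite -kE; ring.
  rewrite /corrector; field.
  by rewrite !gt_eqF.
have h3 : 0 <= h ^+ 3 by rewrite exprn_ge0.
have s1' : 0 <= 1 - s by rewrite subr_ge0.
have B1 : `|s * r1 + (1 - s) * r2 - r3| <= (C * K ^+ 3 + C) * h ^+ 3.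
  rewrite (le_trans (ler_normB _ _))// [leRHS]mulrDl lerD//.
  rewrite (le_trans (ler_normD _ _))// !normrM (ger0_norm s0) (ger0_norm s1').
  rewrite [leRHS](_ : _ = s * (C * K ^+ 3 * h ^+ 3) + (1 - s) * (C * K ^+ 3 * h ^+ 3)); last by ring.
  by apply: lerD; rewrite ler_wpM2l.
have w (e z A : R) : 0 <= e <= 1 -> `|z| <= A -> `|e * z| <= A.
  move=> /andP[e0 e1] zA; rewrite normrM (ger0_norm e0).
  by apply: le_trans zA; rewrite ler_piMl.
have B2 : `|s * (1 - pi) * q1 - (1 - s) * pi * q2 - (1 - pi) * q3| <=
   2 * ((C * K * c + C * c) * h).
  have hs1 : 0 <= s * (1 - pi) <= 1 by rewrite mulr_ge0 ?(ltW pi1')//= mulr_ile1 ?(ltW pi1')//; lra.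
  have hs2 : 0 <= (1 - s) * pi <= 1 by rewrite mulr_ge0 ?(ltW pi0)//= mulr_ile1 ?(ltW pi0)//; lra.
  have hs3 : 0 <= 1 - pi <= 1 by lra.
  have := w _ _ _ hs1 q1C; have := w _ _ _ hs2 q2C; have := w _ _ _ hs3 q3C.
  set a1 := _ * q3; set a2 := _ * q2; set a3 := _ * q1 => z3 z2 z1.
  have Cch : 0 <= C * c * h by rewrite !mulr_ge0// ltW.
  rewrite (le_trans (ler_normB _ _))// (le_trans (lerD (ler_normB _ _) (lexx _)))//.
  by lra.
rewrite (le_trans (ler_normD _ _))// [leRHS]mulrDl lerD//.
rewrite normrM (ger0_norm (divr_ge0 h20 _))// normrM.
rewrite [leRHS](_ : _ = h ^+ 2 / 2 * (`|kappa| * (2 * ((C * K * c + C * c) * h)))); last by field.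
by rewrite ler_wpM2l ?divr_ge0// ler_wpM2l.
Qed.

End OneStep.

(** * Central limit theorem for the two martingales *)

Section Martingale.
Context {R : realType}.
Variables (a p : R).
Notation T := (trans a p).

Let boolR : ((true%:R = 1 :> R) * (false%:R = 0 :> R))%type. Proof. by []. Qed.

Definition mart (b : bool) n (x : cpath n) : R :=
  \sum_(0 <= t < n) (st x t == b)%:R * ((st x t.+1)%:R - T b true).

Lemma mart_extend b n (x : cpath n) j :
  mart b (extend x j) = mart b x + (st x n == b)%:R * (j%:R - T b true).
Proof.
rewrite /mart big_nat_recr//= st_extend// st_extend_last; congr (_ + _).
by apply: eq_big_nat => t /andP[_ tn]; rewrite !st_extend// ltnW.
Qed.

Hypothesis p01 : 0 < p < 1.
Hypothesis T_gt0 : forall i j, 0 < T i j.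
Hypothesis T_sum : forall i, T i true + T i false = 1.
Hypothesis T_stat : p * T true false = (1 - p) * T false true.

Let p01' : 0 <= p <= 1. Proof. by case/andP: p01 => *; rewrite !ltW. Qed.
Let T_ge0 i j : 0 <= T i j. Proof. exact: ltW. Qed.
Let TF i : T i false = 1 - T i true. Proof. by rewrite -(T_sum i) addrC addKr. Qed.
Let T_lt1 i j : T i j < 1.
Proof. by case: j; have := T_gt0 i true; have := T_gt0 i false; have := T_sum i; lra. Qed.

(** Increments have conditional mean 0, so the cross term disappears, and their conditional
    variance, either 0 or [t * (1 - t)], is at most 1. *)
Lemma Expect_mart_sqr b n : Expect a p (fun x : cpath n => mart b x ^+ 2) <= n%:R.
Proof.
elim: n => [|n IHn].
  rewrite -(Expect_cst T_sum 0 0%:R) le_eqVlt; apply/orP; left; apply/eqP.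
  by apply: eq_Expect => x; rewrite /mart big_geq// expr0n.
rewrite Expect_step -natr1 -[X in _ + X](Expect_cst T_sum n 1).
apply: le_trans (lerD IHn (lexx _)); rewrite -ExpectD.
apply: (ler_Expect p01' T_ge0) => x; rewrite big_bool/= !mart_extend.
have [<-|] := eqVneq (st x n) b; last first.
  by rewrite !mul0r !addr0 -mulrDl T_sum mul1r lerDl.
rewrite !mul1r TF; have := T_gt0 (st x n) true; have := T_lt1 (st x n) true.
move: (T _ _) (mart _ _) => t m t1 t0.
rewrite !boolR.
rewrite (_ : _ + _ = m ^+ 2 + t * (1 - t)); last by ring.
by rewrite lerD2l; nra.
Qed.

(** The spectral gap: the second eigenvalue of the transition matrix is [1 - rate], so division by
    [rate] solves the Poisson equation for centered functions. *)
Definition rate := T false true + T true false.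

Let rate_gt0 : 0 < rate. Proof. exact: addr_gt0. Qed.

Lemma init_gt0 i : 0 < init p i < 1.
Proof. by case/andP: p01 => p0 p1; case: i => /=; rewrite /init; apply/andP; split; lra. Qed.

Let initN i : init p (~~ i) = 1 - init p i.
Proof. by case: i; rewrite /init/=; ring. Qed.

Lemma init_rate i : init p i * rate = T (~~ i) i.
Proof. by case: i; rewrite /rate /init /=; move: T_stat; nra. Qed.

(** The standard deviation of one increment of [mart b] under the stationary law. *)
Definition scale (b : bool) := Num.sqrt (init p b * T b true * T b false).

Lemma scale_gt0 b : 0 < scale b.
Proof. by rewrite sqrtr_gt0 !mulr_gt0//; case/andP: (init_gt0 b). Qed.

(** The translation [w] is what allows Gaussian densities evaluated at an arbitrary point as test
    functions. *)
Definition coord n h (w : bool -> R) (b : bool) (x : cpath n) :=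
  h * mart b x / scale b + w b.

(* The [corrector] term is the solution of the Poisson equation that
   compensates the dependence of the conditional variance on the state. *)
Definition corrected h t (i : bool) (z : bool -> R) :=
  bump t^-1 (z i) (z (~~ i))
  + h ^+ 2 / 2 * rate^-1 * (1 - init p i) * corrector (init p i) t (z i) (z (~~ i)).

(** A step from [b] moves only the coordinate of [b], so [lindeberg_step] applies in both states,
    with that coordinate in the role of [x]. *)
Lemma corrected_step (v V : R) : 0 < v -> v <= V -> exists C,
  forall n (x : cpath n) w h t, 0 <= h <= 1 -> v <= t -> t + h ^+ 2 <= V ->
  `|\sum_(j : bool) T (st x n) j * corrected h t j (coord h w ^~ (extend x j))
    - corrected h (t + h ^+ 2) (st x n) (coord h w ^~ x)| <= C * h ^+ 3.
Proof.
move=> v0 vV; pose K := (scale true)^-1 + (scale false)^-1.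
have sc b : 0 < scale b by exact: scale_gt0.
have Kb b : (scale b)^-1 <= K.
  by rewrite /K; case: b; rewrite ?lerDl ?lerDr invr_ge0 ltW.
have K0 : 0 <= K by rewrite addr_ge0// invr_ge0 ltW.
have step (b : bool) : exists C, forall n (x : cpath n) w h t, st x n = b ->
  0 <= h <= 1 -> v <= t -> t + h ^+ 2 <= V ->
  `|\sum_(j : bool) T b j * corrected h t j (coord h w ^~ (extend x j))
    - corrected h (t + h ^+ 2) b (coord h w ^~ x)| <= C * h ^+ 3.
  have s01 : 0 <= T b b <= 1 by rewrite !ltW.
  (* This amounts to [T b b - init p b = (1 - rate) * (1 - init p b)]: the centered indicator of [b]
     is an eigenfunction for the eigenvalue [1 - rate]. *)
  have kE : rate^-1 * (T b b - init p b) + (1 - init p b) = rate^-1 * (1 - init p b).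
    apply: (mulfI (lt0r_neq0 rate_gt0)); rewrite mulrDr !mulrA divff ?lt0r_neq0// !mul1r.
    rewrite mulrBr mulr1 [rate * _]mulrC init_rate /rate.
    by case: (b); rewrite /= TF; ring.
  have [C HC] := lindeberg_step v0 vV (init_gt0 b) s01 K0 kE.
  exists C => n x w h t xb h01 vt tV.
  have /andP[h0 _] := h01.
  have pi0 : init p b != 0 by case/andP: (init_gt0 b) => /lt0r_neq0.
  have pi1 : 1 - init p b != 0 by case/andP: (init_gt0 b) => _; rewrite subr_eq0 => /gt_eqF ->.
  pose d (j : bool) := h * (j%:R - T b true) / scale b.
  have dK j : `|d j| <= K * h.
    have si : 0 < (scale b)^-1 by rewrite invr_gt0.
    rewrite /d !normrM (ger0_norm h0) (gtr0_norm si) -mulrA [leRHS]mulrC ler_wpM2l//.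
    apply: le_trans (Kb b); rewrite ler_piMl ?(ltW si)//.
    by rewrite ler_norml; have := T_gt0 b true; have := T_lt1 b true; case: j; rewrite boolR; lra.
  have cE j : coord h w b (extend x j) = coord h w b x + d j.
    rewrite /coord mart_extend xb eqxx mul1r /d; field.
    by rewrite lt0r_neq0.
  have cN j : coord h w (~~ b) (extend x j) = coord h w (~~ b) x.
    rewrite /coord mart_extend xb (_ : (b == ~~ b) = false); last by case: (b).
    by rewrite mul0r addr0.
  have E1 : T b b * d b + (1 - T b b) * d (~~ b) = 0.
    by rewrite /d; case: (b); rewrite /= ?TF !boolR; ring.
  have sE : scale b ^+ 2 = init p b * T b true * T b false.
    by rewrite sqr_sqrtr// !mulr_ge0//; case/andP: (init_gt0 b) => /ltW.
  have E2 : T b b * d b ^+ 2 + (1 - T b b) * d (~~ b) ^+ 2 = h ^+ 2 / init p b.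
    have -> : T b b * d b ^+ 2 + (1 - T b b) * d (~~ b) ^+ 2 =
        h ^+ 2 * (T b true * T b false) / scale b ^+ 2.
      by rewrite /d; case: (b); rewrite /= ?TF !boolR; field; rewrite lt0r_neq0.
    by rewrite sE; field; rewrite pi0 !lt0r_neq0.
  have := HC t (coord h w b x) (coord h w (~~ b) x) h (d b) (d (~~ b)) h01 vt tV E1 E2
    (dK b) (dK (~~ b)).
  have -> : \sum_(j : bool) T b j * corrected h t j (coord h w ^~ (extend x j)) =
      T b b * corrected h t b (coord h w ^~ (extend x b))
      + (1 - T b b) * corrected h t (~~ b) (coord h w ^~ (extend x (~~ b))).
    by rewrite big_bool/=; case: (b); rewrite /= !TF //; ring.
  rewrite /corrected negbK !cE !cN initN.
  set e1 := (X in `|X| <= _ -> _); set e2 := (X in _ -> `|X| <= _).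
  suff -> : e1 = e2 by [].
  rewrite /e1 /e2; congr (_ + _ * _ - _); rewrite bumpC; congr (_ + _).
  by rewrite /corrector (_ : 1 - (1 - init p b) = init p b); ring.
have [C1 H1] := step true; have [C0 H0] := step false.
exists (Num.max C1 C0) => n x w h t h01 vt tV.
have h3 : 0 <= h ^+ 3 by case/andP: h01 => h0 _; rewrite exprn_ge0.
case E: (st x n).
  by rewrite (le_trans (H1 n x w h t E h01 vt tV))// ler_wpM2r// le_max lexx.
by rewrite (le_trans (H0 n x w h t E h01 vt tV))// ler_wpM2r// le_max lexx orbT.
Qed.

(** The correction is of order [h ^+ 2], so it can be inserted and removed at the two ends of the
    telescoping sum at no loss in the final rate. *)
Lemma corrected_bump (v V : R) : 0 < v -> v <= V -> exists C,
  forall t h i z, v <= t <= V -> 0 <= h <= 1 ->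
  `|corrected h t i z - bump t^-1 (z true) (z false)| <= C * h.
Proof.
move=> v0 vV; have V0 : 0 < V by exact: lt_le_trans vV.
have I0 : 0 < V^-1 by rewrite invr_gt0.
have [C HC] := bounded3_bumpxx v^-1 I0.
exists (rate^-1 * ((init p true)^-1 * C + (init p false)^-1 * C)).
move=> t h i z /andP[vt tV] /andP[h0 h1].
have t0 : 0 < t by exact: lt_le_trans vt.
have tI : V^-1 <= t^-1 <= v^-1 by rewrite !lef_pV2 ?posrE ?tV.
have -> : corrected h t i z - bump t^-1 (z true) (z false) =
   h ^+ 2 / 2 * (rate^-1 * (1 - init p i) * corrector (init p i) t (z i) (z (~~ i))).
  by rewrite /corrected; case: i => /=; rewrite ?[bump _ (z false) _]bumpC; ring.
have C0 : 0 <= C by apply: le_trans (HC _ 0 0 tI).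
have i0 b : 0 <= (init p b)^-1 by rewrite invr_ge0 ltW//; case/andP: (init_gt0 b).
have r0 : 0 <= rate^-1 by rewrite invr_ge0 ltW.
have B : `|corrector (init p i) t (z i) (z (~~ i))| <=
    (init p true)^-1 * C + (init p false)^-1 * C.
  rewrite /corrector -initN (le_trans (ler_normB _ _))// !normrM.
  case: i; rewrite [~~ _]/=; [|rewrite addrC]; apply: lerD; rewrite mulrC (ger0_norm (i0 _));
    by rewrite ler_wpM2l ?i0// -normrM; exact: HC.
set c := corrector _ _ _ _ in B *.
have p1 : 0 <= 1 - init p i <= 1 by have := init_gt0 i; lra.
case/andP: p1 => p10 p11.
rewrite [X in `|X|](_ : _ = h ^+ 2 / 2 * (1 - init p i) * (rate^-1 * c)); last by ring.
rewrite normrM [leRHS]mulrC; apply: ler_pM => //.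
  rewrite ger0_norm ?mulr_ge0 ?sqr_ge0//; nra.
by rewrite normrM (ger0_norm r0) ler_wpM2l.
Qed.

Lemma bump_clt (v : R) : 0 < v -> exists C, forall n w, (0 < n)%N ->
  `|Expect a p (fun x : cpath n => bump v^-1 (coord (Num.sqrt n%:R)^-1 w true x)
                                            (coord (Num.sqrt n%:R)^-1 w false x))
    - bump (v + 1)^-1 (w true) (w false)| <= C / Num.sqrt n%:R.
Proof.
move=> v0; have vV : v <= v + 1 by rewrite lerDl.
have [C HC] := corrected_step v0 vV; have [D HD] := corrected_bump v0 vV.
exists (D + C + D) => n w n0; set h := (Num.sqrt n%:R)^-1.
have nr0 : (0 : R) < n%:R by rewrite ltr0n.
have h2 : h ^+ 2 = n%:R^-1 by rewrite /h exprVn sqr_sqrtr// ltW.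
have h0 : 0 <= h by rewrite invr_ge0.
have h01 : 0 <= h <= 1.
  rewrite h0/= /h invr_le1 ?unitfE ?lt0r_neq0 ?sqrtr_gt0//.
  by rewrite -[leLHS]sqrtr1 ler_wsqrtr// ler1n.
(* The kernel carries the variance of the steps still to come: it starts at [v + 1] and ends at [v].
   Summing the one-step errors gives [n * h ^+ 3], which is [h]. *)
pose tau t := v + (n - t)%:R * h ^+ 2.
have tauS t : (t < n)%N -> tau t.+1 + h ^+ 2 = tau t.
  by move=> tn; rewrite /tau -(subnSK tn) -natr1; ring.
have taun : tau n = v by rewrite /tau subnn mul0r addr0.
have tau0 : tau 0 = v + 1 by rewrite /tau subn0 h2 divff// lt0r_neq0.
have tauv t : v <= tau t by rewrite lerDl mulr_ge0// sqr_ge0.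
have tauV t : tau t <= v + 1.
  by rewrite -tau0 lerD2l ler_wpM2r ?sqr_ge0// ler_nat subn0 leq_subr.
pose e t := Expect a p (fun x : cpath t => corrected h (tau t) (st x t) (coord h w ^~ x)).
have e1 t : (t < n)%N -> `|e t.+1 - e t| <= C * h ^+ 3.
  move=> tn; rewrite /e Expect_step -ExpectB.
  apply: (le_trans (ler_norm_Expect p01' T_ge0 _)).
  rewrite -[leRHS](Expect_cst T_sum t).
  apply: (ler_Expect p01' T_ge0) => x; rewrite -(tauS t tn).
  under eq_bigr do rewrite st_extend_last.
  by apply: HC => //; rewrite (tauS t tn).
have en t : (t <= n)%N -> `|e t - e 0| <= t%:R * (C * h ^+ 3).
  elim: t => [|t IHt] tn; first by rewrite subrr normr0 mul0r.
  rewrite (_ : e t.+1 - e 0 = (e t.+1 - e t) + (e t - e 0)); last by ring.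
  rewrite (le_trans (ler_normD _ _))// -natr1 mulrDl mul1r addrC lerD ?e1//.
  exact/IHt/ltnW.
have {}en : `|e n - e 0| <= C * h.
  apply: le_trans (en n (leqnn n)) _; rewrite (_ : _ * _ = C * h * (n%:R * h ^+ 2)); last by ring.
  by rewrite h2 divff ?lt0r_neq0// mulr1.
have E0 : `|e 0 - bump (v + 1)^-1 (w true) (w false)| <= D * h.
  rewrite -[X in _ - X](Expect_cst T_sum 0) /e -ExpectB.
  apply: (le_trans (ler_norm_Expect p01' T_ge0 _)).
  rewrite -[leRHS](Expect_cst T_sum 0).
  apply: (ler_Expect p01' T_ge0) => x.
  have z b : coord h w b x = w b by rewrite /coord /mart big_geq// mulr0 mul0r add0r.
  rewrite -!z tau0; apply: HD => //.
  by rewrite vV lexx.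
have En : `|Expect a p (fun x : cpath n => bump v^-1 (coord h w true x) (coord h w false x))
    - e n| <= D * h.
  rewrite /e -ExpectB; apply: (le_trans (ler_norm_Expect p01' T_ge0 _)).
  rewrite -[leRHS](Expect_cst T_sum n).
  apply: (ler_Expect p01' T_ge0) => x; rewrite distrC taun.
  by apply: (HD v h (st x n) (coord h w ^~ x)) => //; rewrite vV lexx.
rewrite !mulrDl; set A := Expect _ _ _ in En *.
rewrite (_ : _ - _ = (A - e n) + (e n - e 0) + (e 0 - bump (v + 1)^-1 (w true) (w false))); last by ring.
by rewrite (le_trans (ler_normD _ _))// lerD// (le_trans (ler_normD _ _))// lerD.
Qed.

End Martingale.

(** * Weak convergence from convergence of Gaussian smoothings *)

Section Plane.
Context {R : realType}.

(** Measurability refers to the product sigma-algebra and openness to the product topology; a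
    countable cover by rational squares links the two. *)
Lemma open_measurable_plane (U : set (R * R)) : open U ->
  measurable (U : set (measurableTypeR R * measurableTypeR R)).
Proof.
move=> oU; pose B (q1 q2 r : rat) : set (R * R) :=
  ball (ratr q1 : R) (ratr r : R) `*` ball (ratr q2 : R) (ratr r : R).
have -> : U = \bigcup_(q1 in setT) \bigcup_(q2 in setT) \bigcup_(r in [set r | B q1 q2 r `<=` U]) B q1 q2 r.
  apply/seteqP; split=> [[x y] Uxy|z [q1 _ [q2 _ [r /=]]]]; last exact.
  have /nbhs_ballP[e /= e0 eU] := open_nbhs_nbhs (conj oU Uxy).
  (* The rational center is within [r] of the point and the square has half-side [r], so the square
     stays within [e] of the point. *)
  have [r re] : exists r : rat, 0 < (ratr r : R) < e / 2.
    have [|r] := @rat_in_itvoo R 0 (e / 2); first by rewrite divr_gt0.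
    by rewrite in_itv; exists r.
  case/andP: re => r0 re.
  have appr (z : R) : exists q : rat, `|z - ratr q| < ratr r.
    have [|q] := @rat_in_itvoo R z (z + ratr r); first by rewrite ltrDl.
    rewrite in_itv/= => /andP[zq qz]; exists q.
    by rewrite ltr0_norm ?subr_lt0// opprB ltrBlDl.
  have [q1 Hq1] := appr x; have [q2 Hq2] := appr y.
  exists q1 => //; exists q2 => //; exists r; last first.
    by split => /=; rewrite /ball/= distrC.
  move=> [x' y'] [/= hx hy]; apply: eU; split; rewrite /ball/=.
  + rewrite (_ : x - x' = (x - ratr q1) + (ratr q1 - x')); last by ring.
    by rewrite (le_lt_trans (ler_normD _ _))// [e]splitr ltrD// (lt_trans _ re).
  + rewrite (_ : y - y' = (y - ratr q2) + (ratr q2 - y')); last by ring.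
    by rewrite (le_lt_trans (ler_normD _ _))// [e]splitr ltrD// (lt_trans _ re).
do 2 (apply: bigcupT_measurable_rat => ?).
rewrite bigcup_mkcond; apply: bigcupT_measurable_rat => r; case: ifPn => _ //.
by apply: measurableX; apply: open_measurable; exact: ball_open.
Qed.

Lemma continuous_measurable_plane (f : R * R -> R) :
  continuous f -> measurable_fun [set: measurableTypeR R * measurableTypeR R] f.
Proof.
move=> /continuousP cf; apply: (measurability _ (RGenOpens.measurableE R)).
move=> _ [_ [a [b ->] <-]]; rewrite setTI; apply: open_measurable_plane.
exact/cf/interval_open.
Qed.

(** Only [z] is confined to the square, while [y] may leave it. This is more than uniform continuity
    on the square, and it is obtained from compactness in its covering form. *)
Lemma continuous_uniform_square (f : R * R -> R) B e : continuous f -> 0 < e ->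
  exists2 d, 0 < d & forall z y : R * R, `|z.1| <= B -> `|z.2| <= B ->
    `|y.1 - z.1| < d -> `|y.2 - z.2| < d -> `|f y - f z| < e.
Proof.
move=> cf e0.
have cK : compact (`[- B, B]%classic `*` `[- B, B]%classic : set (R * R)).
  by apply: compact_setX; exact: segment_compact.
pose P (d : R) (z : R * R) := forall y : R * R,
  `|y.1 - z.1| < d -> `|y.2 - z.2| < d -> `|f y - f z| < e.
have : \forall d \near 0^'+, (`[- B, B]%classic `*` `[- B, B]%classic) `<=` P d.
  move/compact_near_coveringP : cK; apply => z _.
  have /cvgrPdist_lt/(_ (e / 2)) := cf z; rewrite divr_gt0// => /(_ isT).
  move=> /nbhs_ballP[r /= r0 rf].
  have r20 : 0 < r / 2 by rewrite divr_gt0.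
  exists (ball z (r / 2), [set d | 0 < d < r / 2]).
    split; first exact: nbhsx_ballx.
    by near=> d; apply/andP; split; near: d; [exact: nbhs_right_gt|exact: nbhs_right_lt].
  move=> [z' d] [/= zz' /andP[d0 dr]] y y1 y2.
  have bz' : ball z r z' by apply: le_ball zz'; rewrite ler_pdivrMr// ler_pMr// ler1n.
  have by_ : ball z r y.
    case: zz' => /= z1 z2; split => /=; rewrite /ball/=.
    + rewrite (_ : z.1 - y.1 = (z.1 - z'.1) - (y.1 - z'.1)); last by ring.
      by rewrite (le_lt_trans (ler_normB _ _))// [r]splitr ltrD// (lt_trans y1).
    + rewrite (_ : z.2 - y.2 = (z.2 - z'.2) - (y.2 - z'.2)); last by ring.
      by rewrite (le_lt_trans (ler_normB _ _))// [r]splitr ltrD// (lt_trans y2).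
  rewrite (_ : f y - f z' = (f z - f z') - (f z - f y)); last by ring.
  rewrite (le_lt_trans (ler_normB _ _))// [e]splitr ltrD//; exact: rf.
move=> H; have [d [d0 Hd]] : exists d : R, 0 < d /\
   (`[- B, B]%classic `*` `[- B, B]%classic) `<=` P d.
  near (0 : R)^'+ => d; exists d; split; near: d => //; exact: nbhs_right_gt.
exists d => // z y z1 z2; apply: Hd.
by split; rewrite /= in_itv/= -ler_norml.
Unshelve. all: by end_near. Qed.

End Plane.

(** * Scheffe's lemma *)

Section Scheffe.
Context d (T : measurableType d) (R : realType).
Variable mu : {measure set T -> \bar R}.

Lemma integrable_density (h : T -> R) : measurable_fun setT h ->
  (forall x, 0 <= h x) -> (\int[mu]_x (h x)%:E = 1)%E ->
  mu.-integrable setT (EFin \o h).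
Proof.
move=> mh h0 h1; apply/integrableP; split; first exact/measurable_EFinP.
under eq_integral do rewrite /= ger0_norm//.
by rewrite h1 ltry.
Qed.

Lemma integrable_subr (f g : T -> R) : mu.-integrable setT (EFin \o f) ->
  mu.-integrable setT (EFin \o g) ->
  mu.-integrable setT (EFin \o (fun x => f x - g x)).
Proof. by move=> mf mg; have := integrableB measurableT mf mg; apply: eq_integrable. Qed.

Lemma integrable_mull (c : R) (f : T -> R) : mu.-integrable setT (EFin \o f) ->
  mu.-integrable setT (EFin \o (fun x => c * f x)).
Proof. by move=> mf; have := integrableZl measurableT c mf; apply: eq_integrable. Qed.

Lemma integrable_bounded_mul (f h : T -> R) M : measurable_fun setT f ->
  (forall x, `|f x| <= M) -> mu.-integrable setT (EFin \o h) ->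
  mu.-integrable setT (EFin \o (fun x => f x * h x)).
Proof.
move=> mf fM ih; have /measurable_EFinP mh := measurable_int mu ih.
apply: (@le_integrable _ _ _ mu _ measurableT _ (fun x => (M * h x)%:E)).
- by apply/measurable_EFinP; exact: measurable_funM.
- move=> x _; rewrite /= lee_fin !normrM ler_wpM2r// (le_trans (fM x))//.
  exact: ler_norm.
- by under eq_fun do rewrite EFinM; exact: integrableZl.
Qed.

(** The sequence [h_] itself has no integrable majorant, but the positive part of [h - h_ k] is
    dominated by [h], and it controls the whole L^1 distance. *)
Lemma Scheffe (h_ : nat -> T -> R) (h f : T -> R) M :
  (forall k, measurable_fun setT (h_ k)) -> measurable_fun setT h ->
  (forall k x, 0 <= h_ k x) -> (forall x, 0 <= h x) ->
  (forall k, \int[mu]_x (h_ k x)%:E = 1)%E -> (\int[mu]_x (h x)%:E = 1)%E ->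
  (forall x, h_ k x @[k --> \oo] --> h x) ->
  measurable_fun setT f -> 0 <= M -> (forall x, `|f x| <= M) ->
  \int[mu]_x (f x * h_ k x) @[k --> \oo] --> \int[mu]_x (f x * h x).
Proof.
move=> mh_ mh h_0 h0 h_1 h1 hcvg mf M0 fM.
have ih_ k := integrable_density (mh_ k) (h_0 k) (h_1 k).
have ih := integrable_density mh h0 h1.
pose g k x := Num.max (h x - h_ k x) 0.
have mg k : measurable_fun setT (g k).
  by apply: measurable_maxr => //; exact: measurable_funB.
have ig k : mu.-integrable setT (EFin \o g k).
  apply: (le_integrable measurableT _ _ ih); first exact/measurable_EFinP.
  move=> x _; rewrite /= lee_fin ger0_norm ?le_max ?lexx ?orbT// ger0_norm// /g ge_max h0 andbT.
  by rewrite lerBlDr lerDl.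
have gcvg : \int[mu]_x (g k x) @[k --> \oo] --> (0 : R).
  have [] := @dominated_convergence _ _ _ mu setT measurableT (fun k x => (g k x)%:E)
    (fun=> 0%E) (EFin \o h).
  - by move=> k; exact/measurable_EFinP.
  - exact: measurable_cst.
  - apply: aeW => x _; apply/fine_cvgP; split; first exact: nearW.
    apply/cvgrPdist_lt => e e0; move/cvgrPdist_lt : (hcvg x) => /(_ e e0).
    apply: filterS => k hk; rewrite /= sub0r normrN ger0_norm ?le_max ?lexx ?orbT//.
    by rewrite /g gt_max e0 andbT (le_lt_trans (ler_norm _)).
  - exact: ih.
  - apply: aeW => x k _; rewrite /= lee_fin ger0_norm ?le_max ?lexx ?orbT//.
    by rewrite /g ge_max h0 andbT lerBlDr lerDl.
  move=> _ _; rewrite integral0 => H.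
  by apply: (@fine_cvg _ _ _ _ _ 0%R); exact: H.
(* Pointwise [|u| = 2 * max(u, 0) - u], and [h - h_ k] has integral 0. *)
have absE k : \int[mu]_x `|h x - h_ k x| = 2 * \int[mu]_x (g k x).
  have -> : \int[mu]_x `|h x - h_ k x| = \int[mu]_x (2 * g k x - (h x - h_ k x)).
    apply: eq_Rintegral => x _; rewrite /g; case: leP => h1'; last first.
      by rewrite gtr0_norm//; ring.
    by rewrite ler0_norm//; ring.
  rewrite RintegralB//; last 2 first.
  - exact: integrable_mull.
  - exact: integrable_subr.
  rewrite RintegralZl// RintegralB// /Rintegral h1 h_1 /=; ring.
have ifh k := integrable_bounded_mul mf fM (ih_ k).
have ifh0 := integrable_bounded_mul mf fM ih.
have ia k : mu.-integrable setT (EFin \o (fun x => `|h x - h_ k x|)).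
  by apply: integrable_norm; exact: integrable_subr.
have Mg : M * (2 * \int[mu]_x (g k x)) @[k --> \oo] --> (0 : R).
  by rewrite -[X in _ --> X](mulr0 M) -[X in M * X](mulr0 2); do 2 apply: cvgMr.
apply/cvgrPdist_le => e e0; move/cvgrPdist_le : Mg => /(_ e e0).
apply: filterS => k; rewrite sub0r normrN => /(le_trans (ler_norm _)).
apply: le_trans; rewrite -RintegralB// -absE -RintegralZl//.
apply: le_trans (le_normr_Rintegral _ _) _ => //.
  exact: integrable_subr.
apply: le_Rintegral => //.
- by apply: integrable_norm; exact: integrable_subr.
- exact: integrable_mull.
- by move=> x _; rewrite -mulrBr normrM ler_wpM2r.
Qed.

End Scheffe.

(** * Bivariate Gaussian densities and smoothing *)

Section Normal2.
Context {R : realType}.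
Variables v11 v12 v22 : R.
Hypothesis v11_gt0 : 0 < v11.
Hypothesis det_gt0 : 0 < v11 * v22 - v12 ^+ 2.
Notation det := (v11 * v22 - v12 ^+ 2).
Notation mu2 := (@lebesgue_measure R \x @lebesgue_measure R)%E.
Implicit Types (t : R) (c y z : R * R).

Lemma v22_gt0 : 0 < v22.
Proof.
by have := det_gt0; rewrite -(pmulr_rgt0 v22 v11_gt0); have := sqr_ge0 v12; lra.
Qed.

Definition qform z := (v22 * z.1 ^+ 2 - 2 * v12 * z.1 * z.2 + v11 * z.2 ^+ 2) / det.

(* Symmetric in [c] and [y]: a density in [y] and a test function in [c]. *)
Definition gauss t c y := normal2_pdf (t * v11) (t * v12) (t * v22) (c.1 - y.1, c.2 - y.2).

Lemma gaussE t c y : 0 < t ->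
  gauss t c y = (2 * pi * Num.sqrt det)^-1 / t
    * expR (- qform (c.1 - y.1, c.2 - y.2) / (2 * t)).
Proof.
move=> t0; rewrite /gauss /normal2_pdf /qform /=.
have -> : t * v11 * (t * v22) - (t * v12) ^+ 2 = t ^+ 2 * det by ring.
rewrite sqrtrM ?sqr_ge0// sqrtr_sqr (gtr0_norm t0).
have s0 : 0 < Num.sqrt det by rewrite sqrtr_gt0.
move: (@pi R) (@pi_gt0 R) => P P0.
congr (_ * expR _).
  by field; rewrite !lt0r_neq0.
by field; rewrite !lt0r_neq0.
Qed.

Lemma gauss_ge0 t c y : 0 < t -> 0 <= gauss t c y.
Proof.
move=> t0; rewrite gaussE// mulr_ge0 ?expR_ge0// mulr_ge0 ?invr_ge0 ?(ltW t0)//.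
by rewrite !mulr_ge0 ?pi_ge0.
Qed.

Lemma continuous_gauss t c : 0 < t -> continuous (gauss t c).
Proof.
move=> t0; have -> : gauss t c = (fun y => (2 * pi * Num.sqrt det)^-1 / t
    * expR (- qform (c.1 - y.1, c.2 - y.2) / (2 * t))).
  by apply/funext => y; rewrite gaussE.
move=> y; apply: cvgMr; apply: (cvg_comp _ expR); last exact: continuous_expR.
rewrite /qform/=.
have c1 : (c.1 - y0.1) @[y0 --> y] --> c.1 - y.1 by apply: cvgB; [exact: cvg_cst|exact: cvg_fst].
have c2 : (c.2 - y0.2) @[y0 --> y] --> c.2 - y.2 by apply: cvgB; [exact: cvg_cst|exact: cvg_snd].
apply: cvgMl; apply: cvgN; apply: cvgMl; apply: cvgD.
  apply: cvgB; first by apply: cvgMr; rewrite !expr2; apply: cvgM.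
  by apply: cvgM => //; apply: cvgMr.
by apply: cvgMr; rewrite !expr2; apply: cvgM.
Qed.

Lemma measurable_gauss t c : 0 < t -> measurable_fun [set: measurableTypeR R * measurableTypeR R] (gauss t c).
Proof. by move=> t0; apply: continuous_measurable_plane; exact: continuous_gauss. Qed.

(** The marginal density of the first coordinate times the conditional density of the second:
    regression slope [v12 / v11], residual variance [t * det / v11]. It reduces the total mass to
    two one-dimensional integrals. *)
Lemma gauss_normal_pdf t c y : 0 < t ->
  gauss t c y = normal_pdf c.1 (Num.sqrt (t * v11)) y.1
    * normal_pdf (c.2 + v12 / v11 * (y.1 - c.1)) (Num.sqrt (t * det / v11)) y.2.
Proof.
move=> t0; have tv : 0 < t * v11 by exact: mulr_gt0.
have tD : 0 < t * det / v11 by rewrite divr_gt0 ?mulr_gt0.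
rewrite !normal_pdfE ?lt0r_neq0 ?sqrtr_gt0// /normal_peak /normal_fun !sqr_sqrtr 1?ltW//.
rewrite mulrACA -expRD gaussE// /qform/=; congr (_ * expR _).
  rewrite -[RHS]invfM -sqrtrM; last by rewrite mulrn_wge0// mulr_ge0 ?pi_ge0// ltW.
  have -> : t * v11 * pi *+ 2 * (t * det / v11 * pi *+ 2) = (2 * pi * t) ^+ 2 * det.
    move: (@pi R) => P.
    by field; rewrite lt0r_neq0.
  rewrite sqrtrM ?sqr_ge0// sqrtr_sqr ger0_norm ?mulr_ge0 ?pi_ge0 ?(ltW t0)//.
  have s0 : 0 < Num.sqrt det by rewrite sqrtr_gt0.
  move: (@pi R) (@pi_gt0 R) => P P0.
  by field; rewrite !lt0r_neq0.
field.
by rewrite !lt0r_neq0.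
Qed.

Lemma integral_gauss t c : 0 < t -> (\int[mu2]_y (gauss t c y)%:E = 1)%E.
Proof.
move=> t0; rewrite fubini_tonelli1; last 2 first.
- by apply/measurable_EFinP; exact: measurable_gauss.
- by move=> y; rewrite lee_fin gauss_ge0.
rewrite /fubini_F -[RHS](integral_normal_pdf c.1 (Num.sqrt (t * v11))).
apply: eq_integral => x _; under eq_integral do rewrite gauss_normal_pdf//= EFinM.
by rewrite integralZl//= ?integral_normal_pdf ?mule1//; exact: integrable_normal_pdf.
Qed.

Lemma integrable_gauss t c : 0 < t -> mu2.-integrable setT (EFin \o gauss t c).
Proof.
move=> t0; apply: integrable_density; [exact: measurable_gauss| |exact: integral_gauss].
by move=> y; exact: gauss_ge0.
Qed.

Lemma Rintegral_gauss t c : 0 < t -> \int[mu2]_y gauss t c y = 1.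
Proof. by move=> t0; rewrite /Rintegral integral_gauss. Qed.

(** Completing the square in either variable leaves [z.1 ^+ 2 / v11], respectively [z.2 ^+ 2 / v22],
    plus a square; the denominator [v11 + v22] covers both cases. *)
Lemma qform_lower z e : 0 <= e -> e <= `|z.1| \/ e <= `|z.2| ->
  e ^+ 2 / (v11 + v22) <= qform z.
Proof.
move=> e0 ez; have v220 := v22_gt0.
have E1 : qform z = z.1 ^+ 2 / v11 + (v11 * z.2 - v12 * z.1) ^+ 2 / (v11 * det).
  by rewrite /qform; field; rewrite !lt0r_neq0.
have E2 : qform z = z.2 ^+ 2 / v22 + (v22 * z.1 - v12 * z.2) ^+ 2 / (v22 * det).
  by rewrite /qform; field; rewrite !lt0r_neq0.
have le (u w q r : R) : 0 < w -> w <= v11 + v22 -> e <= `|u| -> 0 <= r ->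
   q = u ^+ 2 / w + r -> e ^+ 2 / (v11 + v22) <= q.
  move=> w0 wv eu r0 ->; rewrite -[leLHS]addr0 lerD//.
  apply: ler_pM; rewrite ?sqr_ge0 ?invr_ge0//; first by rewrite addr_ge0// ltW.
    by rewrite -[leRHS]real_normK ?num_real// lerXn2r ?nnegrE.
  by rewrite lef_pV2 ?posrE// addr_gt0.
case: ez => ez.
- apply: le E1 => //; first by rewrite lerDl ltW.
  by rewrite divr_ge0 ?sqr_ge0// mulr_ge0// ltW.
- apply: le E2 => //; first by rewrite lerDr ltW.
  by rewrite divr_ge0 ?sqr_ge0// mulr_ge0// ltW.
Qed.

(* Half of the exponent gives the bound, the other half is that of the density
   with twice the variance. *)
Lemma gauss_tail t c y e : 0 < t -> 0 <= e -> e <= `|c.1 - y.1| \/ e <= `|c.2 - y.2| ->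
  gauss t c y <= 2 * expR (- (e ^+ 2 / (v11 + v22)) / (4 * t)) * gauss (2 * t) c y.
Proof.
move=> t0 e0 ez; have t20 : 0 < 2 * t by rewrite mulr_gt0.
have := @qform_lower (c.1 - y.1, c.2 - y.2) e e0 ez.
rewrite !gaussE//; set q := qform _; set b := e ^+ 2 / _ => bq.
set k := (2 * pi * _)^-1.
have k0 : 0 <= k by rewrite invr_ge0 !mulr_ge0 ?pi_ge0.
have -> : 2 * expR (- b / (4 * t)) * (k / (2 * t) * expR (- q / (2 * (2 * t)))) =
    k / t * expR (- b / (4 * t) - q / (4 * t)).
  rewrite expRD (_ : - q / (2 * (2 * t)) = - (q / (4 * t))); last by field; rewrite lt0r_neq0.
  by move: (expR _) (expR (- (q / _))) => X Y; field; rewrite lt0r_neq0.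
have kt0 : 0 <= k / t by rewrite divr_ge0// ltW.
rewrite ler_wpM2l// ler_expR.
rewrite (_ : - q / (2 * t) = - q / (4 * t) - q / (4 * t) :> R); last by field; rewrite lt0r_neq0.
by rewrite lerD2r ler_wpM2r ?lerN2// invr_ge0 mulr_ge0// ltW.
Qed.

(** Within distance [d] of [c] the oscillation is at most [e]. Elsewhere it is at most [2 * M], and
    the factor 2 of [gauss_tail] makes this [4 * M]; the density of doubled variance that remains
    has integral 1. *)
Lemma gauss_smoothing (f : R * R -> R) M t c e d : continuous f ->
  (forall z, `|f z| <= M) -> 0 < t -> 0 <= e -> 0 <= d ->
  (forall y, `|y.1 - c.1| < d -> `|y.2 - c.2| < d -> `|f y - f c| <= e) ->
  `|f c - \int[mu2]_y (f y * gauss t c y)| <=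
    e + 4 * M * expR (- (d ^+ 2 / (v11 + v22)) / (4 * t)).
Proof.
move=> cf fM t0 e0 d0 fe; have t20 : 0 < 2 * t by rewrite mulr_gt0.
have mf := continuous_measurable_plane cf.
have M0 : 0 <= M by exact: le_trans (fM c).
set eta := expR _.
have eta0 : 0 <= eta by exact: expR_ge0.
have ig := integrable_gauss c t0; have ig2 := integrable_gauss c t20.
have ifg := integrable_bounded_mul mf fM ig.
have -> : f c = \int[mu2]_y (f c * gauss t c y).
  by rewrite RintegralZl// Rintegral_gauss// mulr1.
have icg := integrable_mull (f c) ig.
rewrite -RintegralB//; have isub := integrable_subr icg ifg.
apply: (le_trans (le_normr_Rintegral _ isub)) => //.
have ieg := integrable_mull e ig; have ieg2 := integrable_mull (4 * M * eta) ig2.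
have -> : e + 4 * M * eta = \int[mu2]_y (e * gauss t c y + 4 * M * eta * gauss (2 * t) c y).
  rewrite RintegralD//.
  have E1 := RintegralZl e measurableT ig; have E2 := RintegralZl (4 * M * eta) measurableT ig2.
  by rewrite E1 E2 !Rintegral_gauss// !mulr1.
apply: le_Rintegral => //; first exact: integrable_norm.
  by have := integrableD measurableT ieg ieg2; apply: eq_integrable.
move=> y _; rewrite -mulrBl normrM (ger0_norm (gauss_ge0 _ _ t0)).
have g0 := gauss_ge0 c y t0; have g20 := gauss_ge0 c y t20.
have h1 : 0 <= e * gauss t c y by exact: mulr_ge0.
have h2 : 0 <= 4 * M * eta * gauss (2 * t) c y.
  by apply: mulr_ge0 => //; apply: mulr_ge0 => //; exact: mulr_ge0.
have [/andP[y1 y2]|ny] := boolP ((`|y.1 - c.1| < d) && (`|y.2 - c.2| < d)).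
  rewrite -[leLHS]addr0; apply: lerD => //.
  by apply: ler_wpM2r => //; rewrite distrC fe.
rewrite -[leLHS]add0r; apply: lerD => //.
have tl : gauss t c y <= 2 * eta * gauss (2 * t) c y.
  apply: gauss_tail => //; move: ny; rewrite negb_and -!leNgt.
  by rewrite (distrC y.1) (distrC y.2) => /orP[|]; [left|right].
rewrite (_ : 4 * M * eta * _ = (M + M) * (2 * eta * gauss (2 * t) c y)); last by ring.
apply: ler_pM => //.
by rewrite (le_trans (ler_normB _ _))// lerD.
Qed.

End Normal2.

(** * Removal of the smoothing *)

Section Smoothing.
Context {R : realType}.
Variables a p : R.
Hypothesis p01 : 0 <= p <= 1.
Hypothesis T_ge0 : forall i j, 0 <= trans a p i j.
Hypothesis T_sum : forall i, trans a p i true + trans a p i false = 1.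
Variables v11 v12 v22 : R.
Hypothesis v11_gt0 : 0 < v11.
Hypothesis det_gt0 : 0 < v11 * v22 - v12 ^+ 2.
Notation mu2 := (@lebesgue_measure R \x @lebesgue_measure R)%E.
Notation gauss := (gauss v11 v12 v22).

Lemma Expect_integral n (F : cpath n -> R * R -> R) :
  (forall x, mu2.-integrable setT (EFin \o F x)) ->
  mu2.-integrable setT (EFin \o (fun y => Expect a p (F ^~ y))) /\
  \int[mu2]_y Expect a p (F ^~ y) = Expect a p (fun x => \int[mu2]_y F x y).
Proof.
move=> iF; rewrite /Expect; elim: (index_enum _) => [|x s [IH1 IH2]].
  rewrite big_nil; split.
    by apply: eq_integrable (integrable0 mu2 setT) => // y _; rewrite /= big_nil.
  rewrite /Rintegral; under eq_integral do rewrite big_nil.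
  by rewrite integral0.
have ix := integrable_mull (path_prob a p x) (iF x).
rewrite big_cons -IH2 -(RintegralZl _ measurableT (iF x)) -RintegralD//; split.
  apply: eq_integrable (integrableD measurableT ix IH1) => // y _.
  by rewrite /= big_cons.
by apply: eq_Rintegral => y _; rewrite big_cons.
Qed.

Lemma gauss_smoothing_cvg (Z : forall n, cpath n -> R * R) (f : R * R -> R) M t :
  0 < t -> continuous f -> 0 <= M -> (forall z, `|f z| <= M) ->
  (forall y, Expect a p (fun x => gauss t (Z n x) y) @[n --> \oo] --> gauss (t + 1) (0, 0) y) ->
  Expect a p (fun x => \int[mu2]_y (f y * gauss t (Z n x) y)) @[n --> \oo] -->
  \int[mu2]_y (f y * gauss (t + 1) (0, 0) y).
Proof.
move=> t0 cf M0 fM H; have t10 : 0 < t + 1 by rewrite addr_gt0.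
have mf := continuous_measurable_plane cf.
have ig n (x : cpath n) := integrable_gauss v11_gt0 det_gt0 (Z n x) t0.
have ifg n (x : cpath n) := integrable_bounded_mul mf fM (ig n x).
have -> : (fun n => Expect a p (fun x => \int[mu2]_y (f y * gauss t (Z n x) y))) =
    (fun n => \int[mu2]_y (f y * Expect a p (fun x => gauss t (Z n x) y))).
  apply/funext => n; rewrite -(Expect_integral (ifg n)).2.
  by apply: eq_Rintegral => y _; rewrite -ExpectZ.
apply: (@Scheffe _ (measurableTypeR R * measurableTypeR R)%type R mu2 (fun n y => Expect a p (fun x => gauss t (Z n x) y))
  (gauss (t + 1) (0, 0)) f M) => //.
- by move=> n; apply/measurable_EFinP; exact: measurable_int (Expect_integral (ig n)).1.
- exact: measurable_gauss.
- move=> n y; rewrite -(Expect_cst T_sum n 0); apply: (ler_Expect p01 T_ge0) => x.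
  exact: gauss_ge0.
- by move=> y; exact: gauss_ge0.
- move=> n; have [iE intE] := Expect_integral (ig n).
  rewrite -[LHS]fineK; last exact: integrable_fin_num iE.
  rewrite -[fine _]/(\int[mu2]_y Expect a p (fun x => gauss t (Z n x) y)) intE.
  by under eq_Expect do rewrite Rintegral_gauss//; rewrite Expect_cst.
- exact: integral_gauss.
Qed.

Lemma gauss_centered y : gauss 1 (0, 0) y = normal2_pdf v11 v12 v22 y.
Proof.
rewrite /gauss /normal2_pdf !mul1r /= !sub0r !sqrrN.
by rewrite [_ * v12 * - y.1 * - y.2](_ : _ = 2 * v12 * y.1 * y.2)//; ring.
Qed.

Lemma gauss_scale_cvg (f : R * R -> R) M :
  continuous f -> 0 <= M -> (forall z, `|f z| <= M) ->
  \int[mu2]_y (f y * gauss (k.+1%:R^-1 + 1) (0, 0) y) @[k --> \oo] -->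
  \int[mu2]_y (f y * gauss 1 (0, 0) y).
Proof.
move=> cf M0 fM; have k0 k : 0 < k.+1%:R^-1 + 1 :> R by rewrite addr_gt0.
apply: (@Scheffe _ (measurableTypeR R * measurableTypeR R)%type R mu2 (fun k => gauss (k.+1%:R^-1 + 1) (0, 0)) (gauss 1 (0, 0)) f M) => //.
- by move=> k; exact: measurable_gauss.
- exact: measurable_gauss.
- by move=> k y; exact: gauss_ge0.
- by move=> y; exact: gauss_ge0.
- by move=> k; exact: integral_gauss.
- exact: integral_gauss.
- move=> y; have -> : (fun k => gauss (k.+1%:R^-1 + 1) (0, 0) y) =
     (fun k => (2 * pi * Num.sqrt (v11 * v22 - v12 ^+ 2))^-1 / (k.+1%:R^-1 + 1)
    * expR (- qform v11 v12 v22 (0 - y.1, 0 - y.2) / (2 * (k.+1%:R^-1 + 1)))).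
    by apply/funext => k; rewrite gaussE.
  rewrite gaussE//.
  have c1 : (k.+1%:R^-1 + 1 : R) @[k --> \oo] --> (1 : R).
    by rewrite -[X in _ --> X]add0r; apply: cvgD; [exact: cvg_harmonic|exact: cvg_cst].
  apply: cvgM; first by apply: cvgMr; apply: cvgV.
  apply: (cvg_comp _ expR); last exact: continuous_expR.
  by apply: cvgMr; apply: cvgV; [rewrite mulr1|apply: cvgMr].
- exact: continuous_measurable_plane.
Qed.

(** [Z] is the linearized statistic, to which the smoothed limit theorem applies, and [W] the
    statistic of interest. Tightness is required because [f] is uniformly continuous on bounded
    squares only. The choices are made in the order [B], [d], smoothing variance, [n]. *)
Lemma smoothing_criterion (Z W : forall n, cpath n -> R * R) :
  (forall t y, 0 < t ->
    Expect a p (fun x => gauss t (Z n x) y) @[n --> \oo] --> gauss (t + 1) (0, 0) y) ->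
  (forall e, 0 < e -> exists B, \forall n \near \oo,
    Prob a p (fun x => ~~ ((`|(Z n x).1| <= B) && (`|(Z n x).2| <= B))) <= e) ->
  (forall d, 0 < d -> cvg_prob a p (fun u =>
    `|(W (tag u) (tagged u)).1 - (Z (tag u) (tagged u)).1| < d /\
    `|(W (tag u) (tagged u)).2 - (Z (tag u) (tagged u)).2| < d)) ->
  cvg_dist_normal2 a p W v11 v12 v22.
Proof.
move=> HZ tight close f cf [M fM].
have M0 : 0 <= M by exact: le_trans (fM (0, 0)).
have mf := continuous_measurable_plane cf.
have iN : mu2.-integrable setT (EFin \o (fun y => f y * normal2_pdf v11 v12 v22 y)).
  have := integrable_bounded_mul mf fM (integrable_gauss v11_gt0 det_gt0 (0, 0) ltr01).
  by apply: eq_integrable => // y _; rewrite /= gauss_centered.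
rewrite -[X in _ --> X]fineK; last exact: integrable_fin_num iN.
apply: cvg_EFin; first exact: nearW.
rewrite [fine _](_ : _ = \int[mu2]_y (f y * gauss 1 (0, 0) y)); last first.
  by apply: eq_Rintegral => y _; rewrite gauss_centered.
set I0 := \int[mu2]_y _.
(* The error budget: [e] for the limit variance [t + 1] in place of 1, [e] for the convergence at
   fixed [t], and [3 * e + 4 * M * e] for replacing the smoothed [f] at [Z] by [f] at [W]. *)
apply/cvgrPdist_le => e' e'0; pose e := e' / (5 + 4 * M).
have K0 : 0 < 5 + 4 * M by rewrite ltr_wpDr// mulr_ge0.
have e0 : 0 < e by rewrite divr_gt0.
have [B HB] := tight e e0.
have [d d0 Hd] := continuous_uniform_square B cf e0.
have dv0 : 0 < d ^+ 2 / (v11 + v22).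
  by rewrite divr_gt0 ?exprn_gt0// addr_gt0// (v22_gt0 v11_gt0 det_gt0).
pose eta k := 4 * M * expR (- (d ^+ 2 / (v11 + v22)) / (4 * k.+1%:R^-1)).
have Heta : eta k @[k --> \oo] --> (0 : R).
  rewrite -[X in _ --> X](mulr0 (4 * M)); apply: cvgMr.
  (* The majorant comes from [expR (- u) <= u^-1], a consequence of [1 + u <= expR u]. *)
  apply: (squeeze_cvgr (f := fun=> 0) (h := fun k => 4 / (d ^+ 2 / (v11 + v22)) * k.+1%:R^-1)).
  - apply: nearW => k; rewrite expR_ge0/= mulNr expRN.
    set c := _ / (v11 + v22) in dv0 *.
    have kR : (0 : R) < k.+1%:R by [].
    move: (k.+1%:R : R) kR => kk kR.
    rewrite (_ : 4 / c * _ = (c / (4 * kk^-1))^-1); last first.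
      by field; rewrite !lt0r_neq0.
    have u0 : 0 < c / (4 * kk^-1) by rewrite divr_gt0// mulr_gt0// invr_gt0.
    rewrite lef_pV2 ?posrE ?expR_gt0//; apply: le_trans (expR_ge1Dx _).
    by rewrite lerDr.
  - exact: cvg_cst.
  - rewrite -[X in _ --> X](mulr0 (4 / (d ^+ 2 / (v11 + v22)))); apply: cvgMr.
    exact: cvg_harmonic.
have [k [Ik etak]] : exists k,
    `|I0 - \int[mu2]_y (f y * gauss (k.+1%:R^-1 + 1) (0, 0) y)| <= e /\ `|eta k| <= e.
  have /cvgrPdist_le/(_ e e0) H1 := gauss_scale_cvg cf M0 fM.
  move/cvgrPdist_le : Heta => /(_ e e0) H2.
  near \oo => k; exists k; split; first by near: k.
  by rewrite -normrN -sub0r; near: k.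
set t : R := k.+1%:R^-1 in Ik etak.
have t0 : 0 < t by rewrite invr_gt0.
have /cvgrPdist_le/(_ e e0) HJ := gauss_smoothing_cvg t0 cf M0 fM (fun y => HZ t y t0).
have /(cvg_probP p01 T_ge0 T_sum)/(_ e e0) HW := close d d0.
near=> n.
have E1 : `|I0 - \int[mu2]_y (f y * gauss (t + 1) (0, 0) y)| <= e by [].
have E2 : `|\int[mu2]_y (f y * gauss (t + 1) (0, 0) y)
   - Expect a p (fun x => \int[mu2]_y (f y * gauss t (Z n x) y))| <= e by near: n.
have P1 : Prob a p (fun x : cpath n => ~~ ((`|(Z n x).1| <= B) && (`|(Z n x).2| <= B))) <= e.
  by near: n.
have P2 : Prob a p (fun x : cpath n =>
    ~~ `[< `|(W n x).1 - (Z n x).1| < d /\ `|(W n x).2 - (Z n x).2| < d >]) <= e.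
  by near: n.
pose bad1 (x : cpath n) := ~~ ((`|(Z n x).1| <= B) && (`|(Z n x).2| <= B)).
pose bad2 (x : cpath n) := ~~ `[< `|(W n x).1 - (Z n x).1| < d /\ `|(W n x).2 - (Z n x).2| < d >].
have E3 : `|Expect a p (fun x => \int[mu2]_y (f y * gauss t (Z n x) y))
   - Expect a p (fun x => f (W n x))| <= 3 * e + 2 * M * (e + e).
  rewrite -ExpectB; apply: (le_trans (ler_norm_Expect p01 T_ge0 _)).
  apply: (@le_trans _ _ (Expect a p (fun x => 3 * e + 2 * M * ((bad1 x)%:R + (bad2 x)%:R)))).
    apply: (ler_Expect p01 T_ge0) => x; rewrite distrC.
    (* On a bad event the two indicators sum to at least 1, which pays for the trivial bound
       [2 * M]. *)
    have crude (u : R) : 1 <= u ->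
        `|f (W n x) - \int[mu2]_y (f y * gauss t (Z n x) y)| <= 3 * e + 2 * M * u.
      move=> u1; apply: (@le_trans _ _ (M + M)).
        rewrite (le_trans (ler_normB _ _))// lerD//.
        have ig := integrable_gauss v11_gt0 det_gt0 (Z n x) t0.
        have ifg := integrable_bounded_mul mf fM ig.
        apply: (le_trans (le_normr_Rintegral _ ifg)) => //.
        have -> : M = \int[mu2]_y (M * gauss t (Z n x) y).
          by rewrite (RintegralZl M measurableT ig) Rintegral_gauss// mulr1.
        apply: le_Rintegral => //; [exact: integrable_norm|exact: integrable_mull|].
        move=> y _; have g0 := gauss_ge0 det_gt0 (Z n x) y t0.
        by rewrite normrM (ger0_norm g0) ler_wpM2r.
      have e30 : 0 <= 3 * e by rewrite mulr_ge0// ltW.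
      rewrite -[leLHS]add0r lerD//.
      by have -> : M + M = 2 * M * 1 by [ring]; rewrite ler_wpM2l// mulr_ge0.
    have [Zx|b1] := boolP (bad1 x).
      by apply: crude; rewrite lerDl.
    have [Wx|b2] := boolP (bad2 x).
      by apply: crude; rewrite lerDr.
    rewrite addr0 mulr0 addr0.
    move: b1; rewrite negbK => /andP[z1 z2].
    move: b2; rewrite negbK => /asboolP[w1 w2].
    rewrite (_ : _ - _ = (f (W n x) - f (Z n x)) + (f (Z n x) -
       \int[mu2]_y (f y * gauss t (Z n x) y))); last by ring.
    (* One [e] for moving from [W] to [Z], one for the oscillation of [f] near [Z], one for the
       Gaussian tail [eta k]. *)
    have -> : 3 * e = e + (e + e) by ring.
    rewrite (le_trans (ler_normD _ _))// lerD//; first by rewrite ltW// Hd.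
    apply: (le_trans (@gauss_smoothing _ v11 v12 v22 v11_gt0 det_gt0 f M t (Z n x) e d
      cf fM t0 (ltW e0) (ltW d0) _)); last first.
      by rewrite lerD2l (le_trans _ etak)// ler_norm.
    by move=> y y1 y2; rewrite ltW// Hd.
  rewrite ExpectD Expect_cst// lerD2l ExpectZ ler_wpM2l ?mulr_ge0// ExpectD lerD// -ProbE//.
have tri (A B' C D : R) : `|A - D| <= `|A - B'| + (`|B' - C| + `|C - D|).
  rewrite (_ : A - D = (A - B') + ((B' - C) + (C - D))); last by ring.
  by rewrite (le_trans (ler_normD _ _))// lerD// ler_normD.
apply: (le_trans (le_trans (tri _ _ _ _) (lerD E1 (lerD E2 E3)))).
have -> : e' = (5 + 4 * M) * e.
  by rewrite /e mulrC divfK// lt0r_neq0.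
by rewrite le_eqVlt; apply/orP; left; apply/eqP; ring.
Unshelve. all: by end_near. Qed.

End Smoothing.

(** * Transition frequencies *)

Section Counts.
Context {R : realType}.

Lemma ncountE n (x : cpath n) i j :
  (ncount x i j)%:R = \sum_(0 <= t < n) (st x t == i)%:R * (st x t.+1 == j)%:R :> R.
Proof.
rewrite /ncount -sum1_card natr_sum big_mkcond/= big_mkord.
apply: eq_bigr => t _; rewrite -natrM mulnb.
have [tP|/negP tP] := boolP (_ && _); first by rewrite mem_set.
by rewrite memNset.
Qed.

Definition nvisit n (x : cpath n) (i : bool) : R :=
  (ncount x i true)%:R + (ncount x i false)%:R.

Lemma nvisitE n (x : cpath n) i : nvisit x i = \sum_(0 <= t < n) (st x t == i)%:R.
Proof.
rewrite /nvisit !ncountE -big_split/=; apply: eq_bigr => t _.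
by rewrite -mulrDr; case: (st x t.+1); rewrite ?addr0 ?add0r mulr1.
Qed.

Lemma nvisit_sum n (x : cpath n) : nvisit x true + nvisit x false = n%:R.
Proof.
rewrite !nvisitE -big_split/= -[RHS]mulr1 -[n in RHS]subn0 mulr_natl -sumr_const_nat.
by apply: eq_bigr => t _; case: (st x t); rewrite ?addr0 ?add0r.
Qed.

Definition freq n (x : cpath n) (i : bool) : R := (ncount x i true)%:R / nvisit x i.

Definition freq_rate n (x : cpath n) := freq x false + (1 - freq x true).

Lemma sqrt_inv_cvg : (Num.sqrt (n%:R : R))^-1 @[n --> \oo] --> (0 : R).
Proof.
rewrite -cvg_shiftS; apply/cvgrPdist_lt => e e0.
have /cvgrPdist_lt/(_ (e ^+ 2)) := @cvg_harmonic R; rewrite exprn_gt0// => /(_ isT).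
apply: filterS => n; rewrite /= !sub0r !normrN => ne.
have s0 : 0 < Num.sqrt n.+1%:R :> R by rewrite sqrtr_gt0.
rewrite -(@ltr_pXn2r _ 2)// ?nnegrE ?(ltW e0)//.
rewrite gtr0_norm ?invr_gt0// exprVn sqr_sqrtr//.
by apply: le_lt_trans ne; rewrite ler_norm.
Qed.

End Counts.

(** * Consistency and linearization of the frequencies *)

Section Asymptotics.
Context {R : realType}.
Variables (a p : R).
Notation T := (trans a p).
Hypothesis p01 : 0 < p < 1.
Hypothesis T_gt0 : forall i j, 0 < T i j.
Hypothesis T_sum : forall i, T i true + T i false = 1.
Hypothesis T_stat : p * T true false = (1 - p) * T false true.
Notation F := (cvg_prob a p).
Notation lam := (rate a p).

Let p01' : 0 <= p <= 1. Proof. by case/andP: p01 => *; rewrite !ltW. Qed.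
Let T_ge0 i j : 0 <= T i j. Proof. exact: ltW. Qed.
#[local] Instance FF : Filter F. Proof. exact: cvg_prob_filter. Qed.
Let rate_gt0 : 0 < lam. Proof. exact: addr_gt0. Qed.
Let i_gt0 b : 0 < init p b. Proof. by case/andP: (init_gt0 p01 b). Qed.

Lemma mart_count b n (x : cpath n) :
  mart a p b x = (ncount x b true)%:R - T b true * nvisit x b.
Proof.
rewrite nvisitE ncountE /mart big_distrr/= -sumrB; apply: eq_bigr => t _.
by rewrite mulrBr [T b true * _]mulrC eqb_id.
Qed.

(** Summand by summand this is [X_t - T X_t true = lam * (X_t - p)], the Poisson equation of the
    occupation time; the terms [X_t - X_(t+1)] telescope to the boundary term. *)
Lemma nvisit_mart n (x : cpath n) :
  lam * (nvisit x true - n%:R * p) =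
  mart a p true x + mart a p false x + ((st x 0)%:R - (st x n)%:R).
Proof.
have -> : (st x 0)%:R - (st x n)%:R = \sum_(0 <= t < n) ((st x t)%:R - (st x t.+1)%:R) :> R.
  rewrite -[LHS]opprB -(@telescope_sumr _ 0 n (fun t => (st x t)%:R))// -sumrN.
  by apply: eq_bigr => t _; rewrite opprB.
have -> : n%:R * p = \sum_(0 <= t < n) p by rewrite sumr_const_nat subn0 mulr_natl.
rewrite nvisitE /mart -sumrB big_distrr/= -!big_split/=; apply: eq_bigr => t _.
have E1 : T true true = 1 - T true false by rewrite -(T_sum true) addrK.
rewrite /rate; case: (st x t) => /=; case: (st x t.+1) => /=; rewrite ?E1;
  move: T_stat; nra.
Qed.

Lemma cvg_prob_tag (s : nat -> R) (l : R) : s @ \oo --> l -> (fun u : {n & cpath n} => s (tag u)) @ F --> l.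
Proof.
move=> /cvgrPdist_lt sl; apply/cvgrPdist_lt => e /sl [N _ HN].
apply/(cvg_probP p01' T_ge0 T_sum) => d d0; exists N => // n Nn.
rewrite (ProbE a p) (@eq_Expect _ a p n _ (fun=> 0)) ?Expect_cst ?ltW// => x.
by rewrite asboolT//; exact: HN.
Qed.

(** The form of Slutsky's lemma used below: boundedness in L^2 gives tightness, and a tight factor
    times a vanishing one vanishes. *)
Lemma cvg_prob_mulr0 (Y : forall n, cpath n -> R) (G : {n & cpath n} -> R) :
  (forall n, Expect a p (fun x => Y n x ^+ 2) <= 1) -> G @ F --> (0 : R) ->
  (fun u => Y (tag u) (tagged u) * G u) @ F --> (0 : R).
Proof.
move=> Y1 G0; apply/cvgrPdist_lt => e e0; apply/(cvg_probP p01' T_ge0 T_sum) => d d0.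
(* Chebyshev's bound [B ^- 2] is then exactly [d / 2]. *)
pose B := Num.sqrt (2 / d); have B0 : 0 < B by rewrite sqrtr_gt0 divr_gt0.
have d20 : 0 < d / 2 by rewrite divr_gt0.
have /cvgrPdist_lt/(_ (e / B)) := G0; rewrite divr_gt0// => /(_ isT).
move=> /(cvg_probP p01' T_ge0 T_sum)/(_ _ d20); apply: filterS => n Hn.
have HY : Prob a p (fun x : cpath n => B < `|Y n x|) <= d / 2.
  apply: (le_trans (Prob_chebyshev p01' T_ge0 (Y n) B0)).
  have d2 : 0 < 2 / d by rewrite divr_gt0.
  rewrite (sqr_sqrtr (ltW d2)) ler_pdivrMr//.
  by rewrite (_ : d / 2 * (2 / d) = 1) ?Y1//; field; rewrite lt0r_neq0.
rewrite [d]splitr (le_trans _ (lerD Hn HY))// !(ProbE a p) -ExpectD.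
apply: (ler_Expect p01' T_ge0) => x.
case: asboolP => [_|nA]; first by rewrite addr_ge0.
case: asboolP => [G1|_]; last by rewrite -[leLHS]addr0 lerD.
case: ltP => [_|YB]; first by rewrite -[leLHS]add0r lerD.
exfalso; apply: nA; rewrite /= sub0r normrN normrM.
move: G1; rewrite /= sub0r normrN => G1.
by rewrite (le_lt_trans (ler_wpM2r _ YB))// mulrC -ltr_pdivlMr.
Qed.

Definition nmart b n (x : cpath n) := mart a p b x / Num.sqrt n%:R.

Lemma Expect_nmart_sqr b n : Expect a p (fun x : cpath n => nmart b x ^+ 2) <= 1.
Proof.
have -> : Expect a p (fun x : cpath n => nmart b x ^+ 2) =
    n%:R^-1 * Expect a p (fun x : cpath n => mart a p b x ^+ 2).
  rewrite -ExpectZ; apply: eq_Expect => x.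
  by rewrite /nmart exprMn exprVn sqr_sqrtr// mulrC.
have := Expect_mart_sqr p01 T_gt0 T_sum b n.
case: n => [|n] H; first by rewrite invr0 mul0r.
by rewrite mulrC ler_pdivrMr// mul1r.
Qed.

Lemma mart_mean_cvg b : (fun u : {n & cpath n} => mart a p b (tagged u) / (tag u)%:R) @ F --> (0 : R).
Proof.
have := cvg_prob_mulr0 (Expect_nmart_sqr b) (cvg_prob_tag sqrt_inv_cvg).
apply: cvg_trans; apply: near_eq_cvg; apply: nearW => -[n x] /=.
by rewrite /nmart -mulrA -invfM -expr2 sqr_sqrtr.
Qed.

Arguments mart_mean_cvg : clear implicits.

Let inv_cvg : (n%:R : R)^-1 @[n --> \oo] --> (0 : R).
Proof. by rewrite -cvg_shiftS; exact: cvg_harmonic. Qed.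

Lemma tag_gt0 : F [set u | (0 < tag u)%N].
Proof.
apply/(cvg_probP p01' T_ge0 T_sum) => d d0; exists 1%N => // n /= n0.
rewrite (ProbE a p) (@eq_Expect _ a p n _ (fun=> 0)) ?Expect_cst ?ltW// => x.
by rewrite asboolT.
Qed.

Let cvgDF (f g : {n & cpath n} -> R) (l m : R) : f @ F --> l -> g @ F --> m ->
  (fun u => f u + g u) @ F --> l + m.
Proof. by move=> fl gm; apply: cvgD. Qed.

Let cvgBF (f g : {n & cpath n} -> R) (l m : R) : f @ F --> l -> g @ F --> m ->
  (fun u => f u - g u) @ F --> l - m.
Proof. by move=> fl gm; apply: cvgB. Qed.

Let cvgMF (f g : {n & cpath n} -> R) (l m : R) : f @ F --> l -> g @ F --> m ->
  (fun u => f u * g u) @ F --> l * m.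
Proof. by move=> fl gm; apply: cvgM. Qed.

Let cvgVF (f : {n & cpath n} -> R) (l : R) : l != 0 -> f @ F --> l ->
  (fun u => (f u)^-1) @ F --> l^-1.
Proof. by move=> l0 fl; apply: cvgV. Qed.

Let cvgCF (l : R) : (fun _ : {n & cpath n} => l) @ F --> l.
Proof. exact: cvg_cst. Qed.
Arguments cvgCF : clear implicits.

Lemma nvisit_cvg b : (fun u : {n & cpath n} => nvisit (tagged u) b / (tag u)%:R) @ F --> init p b.
Proof.
have bnd : (fun u : {n & cpath n} => ((st (tagged u) 0)%:R - (st (tagged u) (tag u))%:R) / (tag u)%:R)
    @ F --> (0 : R).
  have /cvgrPdist_lt H := cvg_prob_tag inv_cvg; apply/cvgrPdist_lt => e /H.
  apply: (@filterS _ _ FF) => -[n x] /=; rewrite !sub0r !normrN; apply: le_lt_trans.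
  rewrite normrM ler_piMl//.
  by case: (st x 0); case: (st x n); rewrite ?subrr ?subr0 ?sub0r ?normrN ?normr0 ?normr1.
have lim1 : (fun u : {n & cpath n} => nvisit (tagged u) true / (tag u)%:R) @ F --> p.
  have := cvgDF (cvgMF (cvgCF lam^-1) (cvgDF (cvgDF (mart_mean_cvg true) (mart_mean_cvg false)) bnd)) (cvgCF p).
  rewrite !addr0 mulr0 add0r; move=> Hc; apply: (cvg_trans _ Hc); apply: near_eq_cvg.
  move: tag_gt0; apply: (@filterS _ _ FF) => -[n x] /= n0.
  have n1 : (n%:R : R) != 0 by rewrite pnatr_eq0 -lt0n.
  have r0 : lam != 0 by rewrite lt0r_neq0.
  rewrite -!mulrDl -nvisit_mart; field.
  by rewrite n1 r0.
case: b => //; have := cvgBF (cvgCF 1) lim1.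
move=> Hc; apply: (cvg_trans _ Hc); apply: near_eq_cvg; move: tag_gt0; apply: (@filterS _ _ FF) => -[n x] /= n0.
have n1 : (n%:R : R) != 0 by rewrite pnatr_eq0 -lt0n.
by rewrite -(nvisit_sum x); rewrite -(nvisit_sum x) in n1; field.
Qed.

Arguments nvisit_cvg : clear implicits.

(** At an unvisited state [freq] has the default value of a division by 0, so its relation to [mart]
    is used on this event. *)
Lemma nvisit_neq0 b : F [set u | (0 : R) < nvisit (tagged u) b].
Proof.
have /cvgrPdist_lt/(_ _ (i_gt0 b)) := nvisit_cvg b; move: tag_gt0; apply: (@filterS2 _ _ FF) => -[n x] /= n0 H.
have nv0 : 0 <= nvisit x b :> R by rewrite addr_ge0.
rewrite lt_neqAle nv0 andbT; apply: contraTneq H => <-.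
by rewrite mul0r subr0 ltNge negbK ler_norm.
Qed.

Lemma freq_sub b n (x : cpath n) : nvisit x b != 0 :> R ->
  freq x b - T b true = mart a p b x / nvisit x b.
Proof. by move=> v0; rewrite mart_count /freq; field. Qed.

Lemma freq_cvg b : (fun u : {n & cpath n} => freq (tagged u) b) @ F --> T b true.
Proof.
have := cvgDF (cvgMF (mart_mean_cvg b) (cvgVF (lt0r_neq0 (i_gt0 b)) (nvisit_cvg b))) (cvgCF (T b true)).
rewrite mul0r add0r; move=> Hc; apply: (cvg_trans _ Hc); apply: near_eq_cvg.
move: tag_gt0 (nvisit_neq0 b); apply: (@filterS2 _ _ FF) => -[n x] /= n0 v0.
have n1 : (n%:R : R) != 0 by rewrite pnatr_eq0 -lt0n.
have -> : freq x b = mart a p b x / nvisit x b + T b true.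
  by rewrite -freq_sub ?lt0r_neq0// subrK.
by field; rewrite n1 lt0r_neq0.
Qed.

(** The exact ratio between the normalized error of [freq] and [nmart]; it also accounts for the
    norming by [n + 1] instead of [n]. *)
Let normalizer b (u : {n & cpath n}) : R :=
  Num.sqrt ((tag u + 1)%N%:R) / Num.sqrt (tag u)%:R * (nvisit (tagged u) b / (tag u)%:R)^-1.

Let normalizer_cvg b : normalizer b @ F --> (init p b)^-1.
Proof.
rewrite -[X in _ --> X]mul1r; apply: cvgMF; last first.
  by apply: cvgVF; [rewrite lt0r_neq0|exact: nvisit_cvg].
apply: (@cvg_prob_tag (fun n => Num.sqrt ((n + 1)%N%:R) / Num.sqrt n%:R)).
have : Num.sqrt (1 + (n%:R : R)^-1) @[n --> \oo] --> (1 : R).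
  have H : 1 + (n%:R : R)^-1 @[n --> \oo] --> (1 + 0 : R).
    by apply: cvgD; [exact: cvg_cst|exact: inv_cvg].
  rewrite addr0 in H; have := cvg_comp _ Num.sqrt H (@sqrt_continuous R 1).
  by rewrite sqrtr1.
move=> Hc; apply: (cvg_trans _ Hc); apply: near_eq_cvg; exists 1%N => // n /= n0.
have nr0 : (0 : R) < n%:R by rewrite ltr0n.
rewrite -sqrtrV ?ler0n// -sqrtrM ?ler0n//; congr Num.sqrt.
by rewrite natrD mulrDl divff ?lt0r_neq0// mul1r.
Qed.

Lemma freq_normalized b n (x : cpath n) : (0 < n)%N -> 0 < nvisit x b :> R ->
  Num.sqrt ((n + 1)%N%:R) * (freq x b - T b true) = nmart b x * normalizer b (existT _ n x).
Proof.
move=> n0 v0; rewrite freq_sub ?lt0r_neq0// /nmart /normalizer/=.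
have nr0 : (0 : R) < n%:R by rewrite ltr0n.
have s0 : 0 < Num.sqrt n%:R :> R by rewrite sqrtr_gt0.
rewrite invf_div (_ : n%:R / nvisit x b = Num.sqrt n%:R ^+ 2 / nvisit x b); last first.
  by rewrite sqr_sqrtr.
by field; rewrite !lt0r_neq0.
Qed.

Lemma freq_linearization b :
  (fun u : {n & cpath n} => Num.sqrt ((tag u + 1)%N%:R) * (freq (tagged u) b - T b true)
    - nmart b (tagged u) / init p b) @ F --> (0 : R).
Proof.
have G0 : (fun u => normalizer b u - (init p b)^-1) @ F --> (0 : R).
  by rewrite -(subrr (init p b)^-1); apply: cvgBF; [exact: normalizer_cvg|exact: cvgCF].
apply: (cvg_trans _ (cvg_prob_mulr0 (Expect_nmart_sqr b) G0)); apply: near_eq_cvg.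
move: tag_gt0 (nvisit_neq0 b); apply: (@filterS2 _ _ FF) => -[n x] /= n0 v0.
by rewrite freq_normalized// mulrBr.
Qed.

Lemma freq_rate_cvg : (fun u : {n & cpath n} => freq_rate (tagged u)) @ F --> lam.
Proof.
rewrite /rate -[T true false](addKr (T true true)) T_sum [- _ + 1]addrC.
apply: cvgDF; first exact: freq_cvg.
by apply: cvgBF; [exact: cvgCF|exact: freq_cvg].
Qed.

Lemma stationaryE : p = T false true / lam.
Proof.
by apply: (mulIf (lt0r_neq0 rate_gt0)); rewrite divfK ?lt0r_neq0// (init_rate T_stat true).
Qed.

Lemma stationary_cvg : (fun u : {n & cpath n} => freq (tagged u) false / freq_rate (tagged u)) @ F --> p.
Proof.
rewrite [X in _ --> X]stationaryE; apply: cvgMF; first exact: freq_cvg.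
by apply: cvgVF; [rewrite lt0r_neq0|exact: freq_rate_cvg].
Qed.

Lemma stationary_linearization :
  (fun u : {n & cpath n} =>
    Num.sqrt ((tag u + 1)%N%:R) * (freq (tagged u) false / freq_rate (tagged u) - p)
    - (nmart true (tagged u) + nmart false (tagged u)) / lam) @ F --> (0 : R).
Proof.
(* These weights equal [init p b * lam]: they cancel the visit frequencies, so both martingales end
   up with the same coefficient [lam^-1]. *)
pose c b := if b then T false true else T true false.
have G b : (fun u : {n & cpath n} => normalizer b u * (c b / (lam * freq_rate (tagged u)))
    - lam^-1) @ F --> (0 : R).
  have -> : (0 : R) = (init p b)^-1 * (c b / (lam * lam)) - lam^-1.
    have -> : c b = init p b * lam by rewrite (init_rate T_stat) /c; case: b.
    have i0 := lt0r_neq0 (i_gt0 b); have r0 := lt0r_neq0 rate_gt0.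
    by field; rewrite i0 r0.
  apply: cvgBF; last exact: cvgCF.
  apply: cvgMF; first exact: normalizer_cvg.
  apply: cvgMF; first exact: cvgCF.
  apply: cvgVF; first by rewrite mulf_neq0// lt0r_neq0.
  by apply: cvgMF; [exact: cvgCF|exact: freq_rate_cvg].
have := cvgDF (cvg_prob_mulr0 (Expect_nmart_sqr true) (G true))
  (cvg_prob_mulr0 (Expect_nmart_sqr false) (G false)).
rewrite addr0; move=> Hc; apply: (cvg_trans _ Hc); apply: near_eq_cvg.
have rn0 : F [set u | 0 < freq_rate (R := R) (tagged u)].
  have /cvgrPdist_lt/(_ _ rate_gt0) := freq_rate_cvg; apply: (@filterS _ _ FF) => u /=.
  by move=> /(le_lt_trans (ler_norm _)); rewrite ltrBlDr ltrDl.
near=> u.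
have n0 : (0 < tag u)%N by near: u; exact: tag_gt0.
have v0 b : 0 < nvisit (tagged u) b :> R.
  by case: b; near: u; exact: nvisit_neq0.
have q0 : 0 < freq_rate (tagged u) :> R by near: u.
have E b := freq_normalized n0 (v0 b).
rewrite -(_ : u = existT _ (tag u) (tagged u)) in E; last by case: (u).
(* An exact identity for the difference of the two quotients, which replaces the delta method; the
   only random denominator is [freq_rate], whose limit is known. *)
have pE : freq (tagged u) false / freq_rate (tagged u) - p =
  (c false * (freq (tagged u) false - T false true)
   + c true * (freq (tagged u) true - T true true)) / (lam * freq_rate (tagged u)).
  rewrite [in LHS]stationaryE /c.
  have -> : T true true = 1 - T true false by rewrite -(T_sum true) addrK.
  move: (q0) (rate_gt0); rewrite /freq_rate /rate => q1 r1.
  by field; rewrite !lt0r_neq0.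
have dist (s X Y Z : R) : s * ((c false * X + c true * Y) / Z) =
    (c false * (s * X) + c true * (s * Y)) / Z by ring.
rewrite pE dist !E.
have r0 := lt0r_neq0 rate_gt0; have q1 := lt0r_neq0 q0.
by field; rewrite q1 r0.
Unshelve. all: by end_near. Qed.

End Asymptotics.

Arguments freq_cvg {R a p} p01 T_gt0 T_sum T_stat b.
Arguments freq_linearization {R a p} p01 T_gt0 T_sum T_stat b.

(** * Likelihood equations *)

Section Likelihood.
Context {R : realType}.
Implicit Types a p : R.

Lemma trans_compl a p i : 0 < p < 1 -> trans a p i false = 1 - trans a p i true.
Proof.
move=> /andP[p0 p1]; have p10 : 0 < 1 - p by rewrite subr_gt0.
by rewrite /trans; case: ifPn => _; case: i; try ring; field; rewrite lt0r_neq0.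
Qed.

Lemma derive1_compl (f g : R -> R) (x d : R) : is_derive x 1 g d ->
  (\forall y \near x, f y = 1 - g y) -> derive1 f x = - derive1 g x.
Proof.
move=> dg fg; rewrite !derive1E (near_eq_derive _ fg) (derive_val (is_derive := dg)).
have dh : is_derive x 1 (fun y => 1 - g y) (- d).
  by rewrite -[- d]sub0r; exact: is_deriveB.
by rewrite (derive_val (is_derive := dh)).
Qed.

Lemma dtrans_a_compl a p i : 0 < p < 1 -> dtrans_a a p i false = - dtrans_a a p i true.
Proof.
move=> p01; have [d Hd] : exists d, is_derive a 1 (fun b => trans b p i true) d.
  rewrite /trans; case: (p < 2^-1); case: i; eexists; exact: is_derive_eq.
have H : \forall b \near a, trans b p i false = 1 - trans b p i true.
  by near=> b; exact: trans_compl.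
exact: derive1_compl Hd H.
Unshelve. all: by end_near. Qed.

(** [trans] changes its formula at [p = 1/2]. Away from that point it agrees with one fixed rational
    function near [p], and the derivative is computed there. *)
Lemma dtrans_p_compl a p i : 0 < p < 1 -> p != 2^-1 ->
  dtrans_p a p i false = - dtrans_p a p i true.
Proof.
move=> /andP[p0 p1] p2.
have [d Hd] : exists d, is_derive p 1 (fun q => trans a q i true) d.
  have reg (g : R -> R) (d : R) : is_derive p 1 g d ->
      (\forall q \near p, trans a q i true = g q) ->
      exists d, is_derive p 1 (fun q => trans a q i true) d.
    move=> dg tg; exists d; apply: DeriveDef.
      apply: near_eq_derivable (ex_derive (is_derive := dg)).
      by near=> q; apply/esym; near: q.
    by rewrite (near_eq_derive _ tg) (derive_val (is_derive := dg)).
  have [plt|pge] := ltP p 2^-1.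
    have p10 : 1 - p != 0 by rewrite subr_eq0 gt_eqF.
    have dV : is_derive p 1 (fun q : R => (1 - q)^-1) (- (1 - p) ^- 2 *: (0 - 1)).
      exact: (@is_deriveV _ (fun q => 1 - q)).
    case: i reg => reg; [apply: (reg (cst a))|apply: (reg (fun q => q * (1 - a) / (1 - q)))];
      by [exact: is_derive_eq|near=> q; rewrite /trans (_ : q < 2^-1)//; near: q; exact: lt_nbhsl].
  have pgt : 2^-1 < p by rewrite lt_neqAle eq_sym p2.
  have dV : is_derive p 1 (fun q : R => q^-1) (- p ^- 2 *: 1).
    by apply: (@is_deriveV _ id); rewrite lt0r_neq0.
  case: i reg => reg; [apply: (reg (fun q => (a * (1 - q) + 2 * q - 1) / q))|apply: (reg (cst (1 - a)))];
    by [exact: is_derive_eq|near=> q; rewrite /trans ltNge ltW//; near: q; exact: lt_nbhsr].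
have H : \forall q \near p, trans a q i false = 1 - trans a q i true.
  by near=> q; apply: trans_compl; apply/andP; split; near: q; [exact: lt_nbhsr|exact: lt_nbhsl].
exact: derive1_compl Hd H.
Unshelve. all: by end_near. Qed.

(* The likelihood equations are linear in the derivatives of [p_ij]; since
   these add up to 0 over j, they hold as soon as [p_i1 = n_i1 / n_i]. *)
Lemma likelihood_equation n (x : cpath n) (P dP : bool -> bool -> R) :
  (forall i, 0 < (freq x i : R) < 1) -> (forall i, P i true = freq x i) ->
  (forall i, P i false = 1 - P i true) -> (forall i, dP i false = - dP i true) ->
  \sum_(i : bool) \sum_(j : bool) (ncount x i j)%:R / P i j * dP i j = 0.
Proof.
move=> f01 P1 P0 dP0; apply: big1 => i _; rewrite big_bool/= dP0 P0 P1.
have /andP[f0 f1] := f01 i; move: f0 f1; rewrite /freq /nvisit.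
move: (ncount x i true)%:R (ncount x i false)%:R => u v f0 f1.
have uv0 : u + v != 0 by apply: contraTneq f0 => ->; rewrite invr0 mulr0 ltxx.
have u0 : u != 0 by apply: contraTneq f0 => ->; rewrite mul0r ltxx.
have v0 : v != 0 by apply: contraTneq f1 => v0; rewrite v0 addr0 divff ?ltxx.
have vE : 1 - u / (u + v) = v / (u + v) by field.
by rewrite vE !invf_div; field; rewrite u0 v0.
Qed.

(** The parameter [a] is the probability of staying in 1 if [p < 1/2] and of staying in 0 otherwise.
    Membership in the parameter set is not enforced; it holds with probability tending to 1. *)
Definition mle (hi : bool) n (x : cpath n) : R * R :=
  (if hi then 1 - freq x false else freq x true, freq x false / freq_rate x).

Lemma inTheta_p01 hi a p : inTheta hi a p ->
  [/\ 0 < a < 1, 0 < p < 1 & (p < 2^-1) = ~~ hi].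
Proof.
rewrite /inTheta => /andP[-> h]; split => //.
  by case: hi h => h; apply/andP; split; lra.
case: hi h => /andP[h1 h2]; last exact: h2.
by apply/negbTE; rewrite -leNgt ltW.
Qed.

Lemma trans_mle hi n (x : cpath n) i : (forall i, 0 < (freq x i : R) < 1) ->
  ((mle hi x).2 < 2^-1) = ~~ hi ->
  trans (mle hi x).1 (mle hi x).2 i true = freq x i.
Proof.
move=> f01 h; have /andP[t0 t1] := f01 true; have /andP[s0 s1] := f01 false.
have q0 : 0 < freq_rate x :> R by rewrite /freq_rate; lra.
rewrite /trans h /mle /freq_rate in q0 *.
have t10 : 1 - freq x true != 0 :> R by rewrite subr_eq0 gt_eqF.
case: hi h => /= _; case: i => //; first last.
- field; rewrite lt0r_neq0//=.
  by rewrite [X in X != 0](_ : _ = 1 - freq x true)//; ring.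
- by rewrite subKr.
- field; rewrite lt0r_neq0// lt0r_neq0//.
Qed.

Lemma ml_solution_mle hi n (x : cpath n) : (forall i, 0 < (freq x i : R) < 1) ->
  inTheta hi (mle hi x).1 (mle hi x).2 -> ml_solution hi x (mle hi x).
Proof.
move=> f01 th; have [_ p01 h] := inTheta_p01 th.
have p2 : (mle hi x).2 != 2^-1.
  move: th; rewrite /inTheta => /andP[_]; case: (hi) => /andP[] h1 h2.
    by rewrite gt_eqF.
  by rewrite lt_eqF.
rewrite /ml_solution th/=; apply/andP; split; apply/eqP; apply: likelihood_equation => // i.
- exact: trans_mle.
- exact: trans_compl.
- exact: dtrans_a_compl.
- exact: trans_mle.
- exact: trans_compl.
- exact: dtrans_p_compl.
Qed.

End Likelihood.

(** * Limit theorem and tightness for linear statistics of the martingales *)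

Section Limit.
Context {R : realType}.
Variables a p : R.
Notation T := (trans a p).
Hypothesis p01 : 0 < p < 1.
Hypothesis T_gt0 : forall i j, 0 < T i j.
Hypothesis T_sum : forall i, T i true + T i false = 1.
Hypothesis T_stat : p * T true false = (1 - p) * T false true.

(** The hypothesis on [w] diagonalizes the quadratic form in the standardized martingales, so the
    density at [y] becomes a constant multiple of a translated [bump]. The limit value is the same
    expression at martingales equal to 0, with variance [t + 1]. *)
Lemma clt_gauss (v11 v12 v22 c1 c0 d t : R) (y : R * R) (w : bool -> R) :
  0 < t -> 0 < v11 * v22 - v12 ^+ 2 ->
  (forall m1 m0, qform v11 v12 v22 (c1 * m1 + c0 * m0 - y.1, d * (m1 + m0) - y.2) =
     (m1 / scale a p true + w true) ^+ 2 + (m0 / scale a p false + w false) ^+ 2) ->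
  Expect a p (fun x : cpath n => gauss v11 v12 v22 t
    (c1 * nmart a p true x + c0 * nmart a p false x,
     d * (nmart a p true x + nmart a p false x)) y) @[n --> \oo] -->
  gauss v11 v12 v22 (t + 1) (0, 0) y.
Proof.
move=> t0 det0 wE; have t10 : 0 < t + 1 by rewrite addr_gt0.
pose K := (2 * pi * Num.sqrt (v11 * v22 - v12 ^+ 2))^-1.
have gE s m1 m0 : 0 < s ->
    gauss v11 v12 v22 s (c1 * m1 + c0 * m0, d * (m1 + m0)) y =
    K * bump s^-1 (m1 / scale a p true + w true) (m0 / scale a p false + w false).
  move=> s0; rewrite gaussE//= wE /bump /gexp mulrA; congr (_ * expR _).
  by move: (_ ^+ 2 + _ ^+ 2) => u; field; rewrite lt0r_neq0.
have -> : gauss v11 v12 v22 (t + 1) (0, 0) y = K * bump (t + 1)^-1 (w true) (w false).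
  by have := @gE (t + 1) 0 0 t10; rewrite !mulr0 !mul0r !addr0 mulr0 !add0r.
have [C HC] := bump_clt p01 T_gt0 T_sum T_stat t0.
have lim0 : `|K| * (C * (Num.sqrt (n%:R : R))^-1) @[n --> \oo] --> (0 : R).
  rewrite -[X in _ --> X](mulr0 `|K|); apply: cvgMr.
  rewrite -[X in _ --> X](mulr0 C); apply: cvgMr.
  exact: sqrt_inv_cvg.
apply/cvgrPdist_le => e e0; move/cvgrPdist_le : lim0 => /(_ e e0) [N _ HN].
(* The successor excludes [n = 0], where [bump_clt] says nothing. *)
exists N.+1 => // n /= Nn; have n0 : (0 < n)%N by exact: leq_trans Nn.
rewrite distrC.
rewrite (@eq_Expect _ a p n _ (fun x => K * bump t^-1 (coord a p (Num.sqrt n%:R)^-1 w true x)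
   (coord a p (Num.sqrt n%:R)^-1 w false x))); last first.
  by move=> x; rewrite gE// /coord /nmart ![(Num.sqrt _)^-1 * _]mulrC.
rewrite ExpectZ -mulrBr normrM; apply: (@le_trans _ _ (`|K| * (C * (Num.sqrt n%:R)^-1))).
  by rewrite ler_wpM2l// HC.
apply: le_trans (HN n _); last exact: ltnW.
by rewrite sub0r normrN ler_norm.
Qed.

Lemma nmart_tight (c1 c0 d e : R) : 0 < e -> exists B, forall n,
  Prob a p (fun x : cpath n =>
    ~~ ((`|c1 * nmart a p true x + c0 * nmart a p false x| <= B) &&
        (`|d * (nmart a p true x + nmart a p false x)| <= B))) <= e.
Proof.
have p01' : 0 <= p <= 1 by case/andP: p01 => *; rewrite !ltW.
have T_ge0 i j : 0 <= T i j by exact: ltW.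
move=> e0; pose K := Num.sqrt (2 / e).
have e2 : 0 < 2 / e by rewrite divr_gt0.
have K0 : 0 < K by rewrite sqrtr_gt0.
exists ((`|c1| + `|c0| + (`|d| + `|d|)) * K) => n.
have Hb b : Prob a p (fun x : cpath n => K < `|nmart a p b x|) <= e / 2.
  apply: (le_trans (Prob_chebyshev p01' T_ge0 (nmart a p b (n := n)) K0)).
  rewrite (sqr_sqrtr (ltW e2)) ler_pdivrMr//.
  apply: le_trans (Expect_nmart_sqr p01 T_gt0 T_sum b n) _.
  by rewrite (_ : e / 2 * (2 / e) = 1)//; field; rewrite lt0r_neq0.
rewrite [leRHS]splitr; apply: le_trans (lerD (Hb true) (Hb false)).
rewrite !(ProbE a p) -ExpectD; apply: (ler_Expect p01' T_ge0) => x.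
case: (ltP K `|nmart a p true x|) => [_|m1]; first by rewrite -[leLHS]addr0 lerD//; case: (_ && _).
case: (ltP K `|nmart a p false x|) => [_|m0]; first by rewrite -[leLHS]add0r lerD//; case: (_ && _).
rewrite (_ : (_ && _) = true) ?addr0//.
have le u v m m' : `|m| <= K -> `|m'| <= K -> `|u * m + v * m'| <= (`|u| + `|v|) * K.
  by move=> mK m'K; rewrite (le_trans (ler_normD _ _))// mulrDl lerD// normrM ler_wpM2l.
apply/andP; split.
  by rewrite (le_trans (le _ _ _ _ m1 m0))// ler_wpM2r ?(ltW K0)// lerDl addr_ge0.
rewrite mulrDr (le_trans (le _ _ _ _ m1 m0))// ler_wpM2r ?(ltW K0)//.
by rewrite lerDr addr_ge0.
Qed.

End Limit.

(** * Application to the parametrized chain *)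

Section Theta.
Context {R : realType}.
Variables (hi : bool) (a p : R).
Hypothesis th : inTheta hi a p.
Notation T := (trans a p).

Lemma Theta_trans_gt0 i j : 0 < T i j.
Proof.
have [/andP[a0 a1] /andP[p0 p1] plt] := inTheta_p01 th.
have p10 : 0 < 1 - p by rewrite subr_gt0.
have a10 : 0 < 1 - a by rewrite subr_gt0.
have ap0 : 0 < a * p by exact: mulr_gt0.
have ap1 : 0 < a * (1 - p) by exact: mulr_gt0.
rewrite /trans plt; move: th; rewrite /inTheta => /andP[_].
case: (hi) => /= /andP[h1 h2]; case: i; case: j => //; rewrite ?divr_gt0 ?mulr_gt0//; lra.
Qed.

Lemma Theta_trans_sum i : T i true + T i false = 1.
Proof. by have [_ p01 _] := inTheta_p01 th; rewrite trans_compl// addrC subrK. Qed.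

Lemma Theta_stationary : p * T true false = (1 - p) * T false true.
Proof.
have [_ /andP[p0 p1] plt] := inTheta_p01 th; have p10 : 0 < 1 - p by rewrite subr_gt0.
by rewrite /trans plt; case: (hi) => /=; field; rewrite lt0r_neq0.
Qed.

Let det := s11 a p * s22 a p - s12 a p ^+ 2.

Lemma Theta_s11_gt0 : 0 < s11 a p.
Proof.
have [/andP[a0 a1] /andP[p0 p1] plt] := inTheta_p01 th.
have p10 : 0 < 1 - p by rewrite subr_gt0.
have a10 : 0 < 1 - a by rewrite subr_gt0.
by rewrite /s11 plt; case: (hi) => /=; rewrite divr_gt0 ?mulr_gt0.
Qed.

Lemma Theta_detE : det = if hi then a * p * (a * (1 - p) + 2 * p - 1)
  else a * (1 - p) * (a * p + 1 - 2 * p).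
Proof.
have [/andP[a0 a1] /andP[p0 p1] plt] := inTheta_p01 th.
have p10 : 0 < 1 - p by rewrite subr_gt0.
have a10 : 0 < 1 - a by rewrite subr_gt0.
rewrite /det /s11 /s12 /s22 plt; case: (hi) => /=; field; rewrite ?lt0r_neq0//.
Qed.

Lemma Theta_det_gt0 : 0 < det.
Proof.
have [/andP[a0 a1] /andP[p0 p1] plt] := inTheta_p01 th.
have p10 : 0 < 1 - p by rewrite subr_gt0.
rewrite Theta_detE; move: th; rewrite /inTheta => /andP[_].
have ap0 : 0 < a * p by exact: mulr_gt0.
have ap1 : 0 < a * (1 - p) by exact: mulr_gt0.
by case: (hi) => /= /andP[h1 h2]; rewrite mulr_gt0//; lra.
Qed.

(** [c1] and [c0] are the coefficients of the two normalized martingales in the linearized error of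
    the estimator of [a], which involves a single row of the transition matrix. *)
Let c1 := if hi then 0 else p^-1.
Let c0 := if hi then - (1 - p)^-1 else 0.

(** Here the covariance matrix of the statement is verified: the linearized estimator, as a linear
    image of two uncorrelated martingales with standard deviations [scale], has exactly this
    matrix. *)
Lemma Theta_qform (y : R * R) : exists w : bool -> R, forall m1 m0,
  qform (s11 a p) (s12 a p) (s22 a p)
    (c1 * m1 + c0 * m0 - y.1, (rate a p)^-1 * (m1 + m0) - y.2) =
  (m1 / scale a p true + w true) ^+ 2 + (m0 / scale a p false + w false) ^+ 2.
Proof.
have [/andP[a0 a1] p01 plt] := inTheta_p01 th; have /andP[p0 p1] := p01.
have p10 : 0 < 1 - p by rewrite subr_gt0.
have a10 : 0 < 1 - a by rewrite subr_gt0.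
have sc b : 0 < scale a p b by exact: scale_gt0 p01 Theta_trans_gt0 b.
have scE b : scale a p b ^+ 2 = init p b * T b true * T b false.
  rewrite sqr_sqrtr// !mulr_ge0//; last by rewrite ltW// Theta_trans_gt0.
    by case/andP: (init_gt0 p01 b) => /ltW.
  by rewrite ltW// Theta_trans_gt0.
(* Only squares of [scale] occur in this form, so the identity is one between rational functions of
   [a] and [p]. *)
have [w1 [w0 H]] : exists w1 w0, forall m1 m0,
    qform (s11 a p) (s12 a p) (s22 a p)
      (c1 * m1 + c0 * m0 - y.1, (rate a p)^-1 * (m1 + m0) - y.2) =
    (m1 - w1) ^+ 2 / scale a p true ^+ 2 + (m0 - w0) ^+ 2 / scale a p false ^+ 2.
  (* [w1] and [w0] are the values of the martingales at which the linear statistic equals [y]. *)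
  pose w1 := if hi then rate a p * y.2 + (1 - p) * y.1 else p * y.1.
  pose w0 := if hi then - ((1 - p) * y.1) else rate a p * y.2 - p * y.1.
  exists w1, w0 => m1 m0; rewrite !scE.
  have r0 : rate a p != 0 by rewrite lt0r_neq0// addr_gt0// Theta_trans_gt0.
  have -> : c1 * m1 + c0 * m0 - y.1 = c1 * (m1 - w1) + c0 * (m0 - w0).
    by rewrite /c1 /c0 /w1 /w0; case: (hi) => /=; field; rewrite lt0r_neq0.
  have -> : (rate a p)^-1 * (m1 + m0) - y.2 = (rate a p)^-1 * ((m1 - w1) + (m0 - w0)).
    by rewrite /w1 /w0; case: (hi) => /=; field.
  move: (m1 - w1) (m0 - w0) => A B; rewrite /qform -/det Theta_detE.
  have D0 := Theta_det_gt0; rewrite Theta_detE in D0.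
  rewrite /c1 /c0 /rate /s11 /s12 /s22 /trans plt; move: D0; case: (hi) => /= D0.
    have q0 : 0 < a * (1 - p) + 2 * p - 1 by rewrite -(pmulr_rgt0 _ (mulr_gt0 a0 p0)).
    by field; rewrite !lt0r_neq0.
  have q0 : 0 < a * p + 1 - 2 * p by rewrite -(pmulr_rgt0 _ (mulr_gt0 a0 p10)).
  by field; rewrite !lt0r_neq0.
exists (fun b => - (if b then w1 else w0) / scale a p b) => m1 m0.
by rewrite H; field; rewrite !lt0r_neq0.
Qed.

Notation F := (cvg_prob a p).

Let p01 : 0 < p < 1. Proof. by have [] := inTheta_p01 th. Qed.
Let p01' : 0 <= p <= 1. Proof. by case/andP: p01 => *; rewrite !ltW. Qed.
Let T_gt0 := Theta_trans_gt0.
Let T_sum := Theta_trans_sum.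
Let T_stat := Theta_stationary.
Let T_ge0 i j : 0 <= T i j. Proof. by rewrite ltW// Theta_trans_gt0. Qed.

#[local] Instance Theta_filter : Filter F.
Proof. exact: (cvg_prob_filter p01' T_ge0 T_sum). Qed.

Let near_lt (f : {n & cpath n} -> R) (l c : R) : f @ F --> l -> l < c ->
  \forall u \near F, f u < c.
Proof. by move=> fl; exact: (cvgr_lt _ fl). Qed.

Let near_gt (f : {n & cpath n} -> R) (l c : R) : f @ F --> l -> c < l ->
  \forall u \near F, c < f u.
Proof. by move=> fl; exact: (cvgr_gt _ fl). Qed.

Let aE : a = if hi then 1 - T false true else T true true.
Proof.
have [_ _ plt] := inTheta_p01 th.
by rewrite /trans plt; case: (hi) => //=; rewrite subKr.
Qed.

Lemma mle1_cvg : (fun u : {n & cpath n} => (mle hi (tagged u)).1) @ F --> a.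
Proof.
rewrite [X in _ --> X]aE /mle; case: (hi) => /=; last exact: freq_cvg p01 T_gt0 T_sum T_stat true.
by apply: cvgB; [exact: cvg_cst|exact: freq_cvg p01 T_gt0 T_sum T_stat false].
Qed.

Lemma mle2_cvg : (fun u : {n & cpath n} => (mle hi (tagged u)).2) @ F --> p.
Proof. exact: stationary_cvg p01 T_gt0 T_sum T_stat. Qed.

(** What [ml_solution_mle] requires is a finite list of strict inequalities, all satisfied by the
    limits in probability of the quantities involved. *)
Lemma mle_solution :
  Prob a p (fun x : cpath n => ml_solution hi x (mle hi x : R * R)) @[n --> \oo] --> (1 : R).
Proof.
pose S := [set u | ml_solution hi (tagged u) (mle hi (tagged u) : R * R)].
have -> : (fun n => Prob a p (fun x : cpath n => ml_solution hi x (mle hi x : R * R))) =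
    (fun n => Prob a p (fun x : cpath n => `[< S (existT _ n x) >])).
  by apply/funext => n; apply: eq_bigl => x; rewrite asboolb.
(* By definition of [cvg_prob], this convergence is membership of [S] in the filter. *)
change (F S); rewrite /S {S}.
have T1 j : T j true < 1 by rewrite -(T_sum j) ltrDl.
have [/andP[a0 a1] /andP[p0 p1] _] := inTheta_p01 th.
have B3 : \forall u \near F,
    if hi then 2^-1 < (mle hi (tagged u)).2 :> R else (mle hi (tagged u)).2 < 2^-1 :> R.
  move: th mle2_cvg; rewrite /inTheta => /andP[_]; case: (hi) => /= /andP[h1 h2] H.
    by have := near_gt H h1.
  by have := near_lt H h2.
near=> u; apply: ml_solution_mle.
  have f1 i : freq (tagged u) i < 1 :> R.
    by case: i; near: u; exact: (near_lt (freq_cvg p01 T_gt0 T_sum T_stat _) (T1 _)).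
  have f0 i : 0 < freq (tagged u) i :> R.
    by case: i; near: u; exact: (near_gt (freq_cvg p01 T_gt0 T_sum T_stat _) (T_gt0 _ _)).
  by move=> i; rewrite f0 f1.
have b1 : 0 < ((mle hi (tagged u)).1 : R) < 1.
  by apply/andP; split; near: u; [exact: (near_gt mle1_cvg a0)|exact: (near_lt mle1_cvg a1)].
have b0 : 0 < (mle hi (tagged u)).2 :> R by near: u; exact: (near_gt mle2_cvg p0).
have b2 : (mle hi (tagged u)).2 < 1 :> R by near: u; exact: (near_lt mle2_cvg p1).
have b3 : if hi then 2^-1 < (mle hi (tagged u)).2 :> R else (mle hi (tagged u)).2 < 2^-1 :> R.
  by near: u.
by rewrite /inTheta b1/=; case: (hi) b3 => ->; rewrite ?b0 ?b2.
Unshelve. all: by end_near. Qed.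

Lemma mle_consistent (e : R) : 0 < e ->
  Prob a p (fun x : cpath n => (e <= `|(mle hi x).1 - a|) || (e <= `|(mle hi x).2 - p|))
    @[n --> \oo] --> (0 : R).
Proof.
move=> e0.
have : F [set u | (`|(mle hi (tagged u)).1 - a| < e) && (`|(mle hi (tagged u)).2 - p| < e)].
  have /cvgrPdist_lt/(_ e e0) H1 := mle1_cvg; have /cvgrPdist_lt/(_ e e0) H2 := mle2_cvg.
  by near=> u; apply/andP; split; rewrite distrC; near: u.
move=> /(cvg_probP p01' T_ge0 T_sum) H; apply/cvgrPdist_le => d d0; move: (H d d0).
apply: filterS => n; rewrite sub0r normrN ger0_norm; last exact: (Prob_ge0 p01' T_ge0).
apply: le_trans; apply: (ler_Prob p01' T_ge0) => x; rewrite asboolb negb_and -!leNgt.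
by [].
Unshelve. all: by end_near. Qed.

(** The criterion is applied with [Z] the linear statistic of the martingales; the estimator is
    close to it by the two linearizations. *)
Lemma mle_normal : cvg_dist_normal2 a p
  (fun n (x : cpath n) => (Num.sqrt ((n + 1)%N%:R : R) * ((mle hi x).1 - a),
                           Num.sqrt ((n + 1)%N%:R : R) * ((mle hi x).2 - p)))
  (s11 a p) (s12 a p) (s22 a p).
Proof.
apply: (smoothing_criterion p01' T_ge0 T_sum Theta_s11_gt0 Theta_det_gt0
  (Z := fun n x => (c1 * nmart a p true x + c0 * nmart a p false x,
                    (rate a p)^-1 * (nmart a p true x + nmart a p false x)))).
- move=> t y t0; have [w Hw] := Theta_qform y.
  exact: (clt_gauss p01 T_gt0 T_sum T_stat t0 Theta_det_gt0 Hw).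
- move=> e e0; have [B HB] := nmart_tight p01 T_gt0 T_sum c1 c0 (rate a p)^-1 e0.
  by exists B; exact: nearW.
move=> d d0.
have L1 : (fun u : {n & cpath n} => Num.sqrt ((tag u + 1)%N%:R) * ((mle hi (tagged u)).1 - a)
   - (c1 * nmart a p true (tagged u) + c0 * nmart a p false (tagged u))) @ F --> (0 : R).
  move: aE; rewrite /c1 /c0 /mle; case: (hi) => /= aE'.
    have E (f : R) : 1 - f - a = - (f - T false true) by have := aE'; lra.
    rewrite (_ : (fun u => _) = (fun u => - (Num.sqrt ((tag u + 1)%N%:R)
      * (freq (tagged u) false - T false true) - nmart a p false (tagged u) / init p false))).
      by rewrite -oppr0; apply: cvgN; exact: freq_linearization p01 T_gt0 T_sum T_stat false.
    by apply/funext => u; rewrite E /init; ring.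
  have E (f : R) : f - a = f - T true true by have := aE'; lra.
  rewrite (_ : (fun u => _) = (fun u => Num.sqrt ((tag u + 1)%N%:R)
      * (freq (tagged u) true - T true true) - nmart a p true (tagged u) / init p true)).
    exact: freq_linearization p01 T_gt0 T_sum T_stat true.
  by apply/funext => u; rewrite E /init; ring.
have L2 := stationary_linearization p01 T_gt0 T_sum T_stat.
have /cvgrPdist_lt/(_ d d0) H1 := L1; have /cvgrPdist_lt/(_ d d0) H2 := L2.
near=> u; split; rewrite /=.
  by rewrite -normrN -sub0r; near: u.
rewrite -normrN -sub0r [_^-1 * _]mulrC; near: u; exact: H2.
Unshelve. all: by end_near. Qed.

End Theta.

Theorem theorem3 (R : realType) (hi : bool) :
  exists est : forall n : nat, cpath n -> R * R,
  forall a p : R, inTheta hi a p ->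
    (* with probability -> 1, est is a solution of the likelihood equations *)
    (Prob a p (fun x => ml_solution hi x (est n x)) @[n --> \oo] --> (1:R)) /\
    (* consistency *)
    (forall eps : R, 0 < eps ->
       Prob a p (fun x => (eps <= `|(est n x).1 - a|) || (eps <= `|(est n x).2 - p|))
         @[n --> \oo] --> (0:R)) /\
    (* asymptotic normality of sqrt(n+1) (est - theta) *)
    cvg_dist_normal2 a p
      (fun n x => (Num.sqrt ((n + 1)%N%:R : R) * ((est n x).1 - a),
                   Num.sqrt ((n + 1)%N%:R : R) * ((est n x).2 - p)))
      (s11 a p) (s12 a p) (s22 a p).
Proof.
exists (fun n x => mle hi x) => a p th; split; first exact: mle_solution.
by split; [exact: mle_consistent|exact: mle_normal].
Qed.
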